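(* Let $\lambda,\kappa\geq 1$ and $\gamma\geq 2$ be cardinals. The $(\lambda,\kappa,\gamma)$-hat game is losing (i.e. the logicians have no winning strategy) in exactly the following cases: (1) $\lambda$ and $\gamma$ are finite and $\kappa\geq \lambda\cdot(\gamma-1)+1$; (2) $\lambda$ is finite, $\gamma$ is infinite and $\kappa\geq\gamma^{+(\lambda-1)}$; (3) $\lambda$ is infinite, $\gamma$ is finite and $\kappa$ is infinite; (4) $\lambda$ and $\gamma$ are infinite and there is a strongly MInA cardinal $\mu$ with $\gamma<\mu\leq\kappa$ (i.e. $\kappa$ is at least as large as the least strongly MInA cardinal above $\gamma$). In all other cases the game is winning.
   Context: The $(\lambda,\kappa,\gamma)$-hat game: there is one logician for each $\alpha<\lambda$; each wears a hat with a colour in $\kappa$. Equip $\kappa$ and $[\kappa]^{<\gamma}$ (subsets of $\kappa$ of size $<\gamma$) with the discrete topology and $\kappa^{\lambda\setminus\{\alpha\}}$ with the product topology. A strategy is a sequence $\langle f_\alpha\mid\alpha<\lambda\rangle$ of continuous functions $f_\alpha\colon\kappa^{\lambda\setminus\{\alpha\}}\to[\kappa]^{<\gamma}$ (logician $\alpha$ looks at finitely many other hats and guesses fewer than $\gamma$ colours). It is winning if for every colouring $h\colon\lambda\to\kappa$ there is $\alpha<\lambda$ with $h(\alpha)\in f_\alpha(h\restriction(\lambda\setminus\{\alpha\}))$. The game is winning if a winning strategy exists, and losing otherwise. $\gamma^{+n}$ denotes the $n$-th cardinal successor of $\gamma$ ($\gamma^{+0}=\gamma$). For infinite cardinals $\kappa,\gamma$: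 given a set $\mathcal F$ of functions $f\colon\kappa^{n_f}\to[\kappa]^{<\gamma}$ ($n_f<\omega$), a set $A\subseteq\kappa$ is mutually $\mathcal F$-independent if for all $\alpha\in A$, $f\in\mathcal F$ and $\alpha_1,\dots,\alpha_{n_f}\in A\setminus\{\alpha\}$ we have $\alpha\notin f(\alpha_1,\dots,\alpha_{n_f})$. $\kappa$ has the $\gamma$-MInA if for every countable such $\mathcal F$ there is a countably infinite mutually $\mathcal F$-independent $A\subseteq\kappa$. An infinite cardinal $\kappa$ is strongly MInA if it has the $\gamma$-MInA for every infinite cardinal $\gamma<\kappa$. *)

(* Defs.v *)
(* A cardinal is presented by a type of that cardinality; every notion below
   depends on its type arguments only up to bijection. *)
From HB Require Import structures.
From mathcomp Require Import all_boot all_classical topology.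

Local Open Scope classical_set_scope.
Local Open Scope card_scope.

Definition card_lt {T U : Type} (A : set T) (B : set U) : Prop :=
  A #<= B /\ ~ (B #<= A).

Notation "A '#<' B" := (card_lt A B) (at level 79) : card_scope.

Definition is_card_succ (G S : Type) : Prop :=
  [set: G] #< [set: S] /\
  forall X : Type, [set: G] #< [set: X] -> [set: S] #<= [set: X].

(* [S] has cardinality $\gamma^{+n}$, where $\gamma = |G|$. *)
Fixpoint is_card_succn (n : nat) (G S : Type) : Prop :=
  if n is m.+1 then exists2 X : Type, is_card_succn m G X & is_card_succ X S
  else [set: S] #= [set: G].

(* $[\kappa]^{<\gamma}$ *)
Definition small_sets (K G : Type) : set (set K) :=
  [set A : set K | A #< [set: G]].

(* {classic _} only supplies the choiceType structure that discrete_topology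
   asks for. *)
Definition hats_seen {L : Type} (K : Type) (a : L) : topologicalType :=
  prod_topology (fun _ : [set~ a] => discrete_topology {classic K}).

Definition guesses (K G : Type) : topologicalType :=
  discrete_topology {classic small_sets K G}.

Definition is_strategy {L K G : Type}
    (f : forall a : L, hats_seen K a -> guesses K G) : Prop :=
  forall a : L, continuous (f a).

Definition restrict_away {L K : Type} (h : L -> K) (a : L) : hats_seen K a :=
  fun b => h (val b).

Definition guessed_set {K G : Type} (s : guesses K G) : set K :=
  @set_val _ (small_sets K G) s.

Definition winning_strategy {L K G : Type}
    (f : forall a : L, hats_seen K a -> guesses K G) : Prop :=
  is_strategy f /\
  forall h : L -> K, exists a : L, guessed_set (f a (restrict_away h a)) (h a).

Definition winning_game (L K G : Type) : Prop :=
  exists f : forall a : L, hats_seen K a -> guesses K G, winning_strategy f.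

Definition losing_game (L K G : Type) : Prop := ~ winning_game L K G.

(* A family of functions of arbitrary finite arities is a set of dependent
   pairs (arity, function). *)
Definition finitary_fun (K G : Type) : Type :=
  {n : nat & ('I_n -> K) -> small_sets K G}.

Definition mutually_independent {K G : Type} (F : set (finitary_fun K G))
    (A : set K) : Prop :=
  forall (a : K) (f : finitary_fun K G), A a -> F f ->
  forall v : 'I_(projT1 f) -> K, (forall i, (A `\ a) (v i)) ->
  ~ set_val (projT2 f v) a.

Definition MInA (K G : Type) : Prop :=
  forall F : set (finitary_fun K G), countable F ->
  exists A : set K, A #= [set: nat] /\ mutually_independent F A.

Definition strongly_MInA (K : Type) : Prop :=
  infinite_set [set: K] /\
  forall G : Type, infinite_set [set: G] -> [set: G] #< [set: K] -> MInA K G.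

Definition losing_case (L K G : Type) : Prop :=
  [\/ (exists l g : nat, [/\ [set: L] #= `I_l, [set: G] #= `I_g &
         `I_(l * (g - 1) + 1) #<= [set: K]]),
      (exists (l : nat) (S : Type), [/\ [set: L] #= `I_l,
         infinite_set [set: G], is_card_succn (l - 1) G S &
         [set: S] #<= [set: K]]),
      [/\ infinite_set [set: L], finite_set [set: G] &
         infinite_set [set: K]] |
      [/\ infinite_set [set: L], infinite_set [set: G] &
         exists M : Type, [/\ strongly_MInA M, [set: G] #< [set: M] &
           [set: M] #<= [set: K]]]].

(* Main.v *)
(* Strategies are treated as maps f_a : (L -> K) -> set K that ignore the hat of a
   and are locally constant.

   Finite games.  With finitely many guesses, in a losing game each logician is
   right for at most a fraction (g - 1) / |K| of the colourings; in a winning one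
   logician a guesses that the sum of all hats modulo |K| lies in the a-th block
   of length g - 1.  With infinite G one argues as for the Kuratowski-Sierpinski
   free set theorem: if the first n logicians use only |G|^+(n-1) colours, their
   colourings are too few for the guesses of the next logician to cover |G|^+n;
   conversely, in a well-order whose proper segments are small, a logician assumes
   that the maximal hat seen is the overall maximum, and plays with the remaining
   logicians the game on the colours below it.

   Infinite losing games.  By Zorn's lemma it suffices to defeat, against a
   strategy, some set N of logicians containing a given one by a colouring of N
   alone.  N is the countable set of positions reached from that logician by
   following the hats that are looked at.  If G is finite, finite parts of N are
   defeated with fast growing finite sets of colours, and an ultrafilter limit
   defeats N.  If K has the G-MInA, everything that happens in N is described by
   countably many finitary functions of the colours used, and N is coloured
   injectively by an independent set.

   Infinite winning games.  If Q colours win and K does not have the Q-MInA, then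
   K colours win: split the logicians into blocks; in each block some colour lies
   in a set of size less than Q computed from other colours of the block, which
   gives the block a virtual hat in Q, and the blocks play the winning game for Q
   with these hats.  Well-foundedness of cardinals then reaches every K below the
   first strongly MInA cardinal above G. *)
Require Import Defs.
From mathcomp Require Import all_boot all_classical topology wochoice.
Set Implicit Arguments.
Unset Strict Implicit.
Unset Printing Implicit Defensive.
Local Open Scope classical_set_scope.
Local Open Scope card_scope.

(** * Cardinals *)

Lemma card_le_inj T U (A : set T) (B : set U) (f : T -> U) :
  (forall x, A x -> B (f x)) ->
  (forall x y, A x -> A y -> f x = f y -> x = y) -> A #<= B.
Proof.
move=> fAB fI; have /injfunPex [g] : exists2 f : T -> U, set_fun A B f & set_inj A f.
  by exists f => // x y /set_mem Ax /set_mem Ay; apply: fI.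
exact: inj_card_le.
Qed.

Lemma card_leW T U (A : set T) (B : set U) (u : U) : A #<= B ->
  exists f : T -> U, (forall x, A x -> B (f x)) /\
    (forall x y, A x -> A y -> f x = f y -> x = y).
Proof.
elim/Ppointed: U => U in B u *; first by have := no u.
move=> /pcard_leP[f]; exists f; split; first by move=> x Ax; apply: funS.
by move=> x y /mem_set Ax /mem_set Ay; apply: inj.
Qed.

Lemma card_le_sub T U (A : set T) (B : set U) : A #<= B ->
  exists C, C `<=` B /\ C #= A.
Proof. by move=> /card_subP[C ? ?]; exists C. Qed.

(** A partial function is a domain with a total function whose values off the domain do not count.
    Extension is then only a preorder, and the union of a chain is tested against every [p] that
    agrees with its members. *)
Lemma zorn_partial_fun D E (P : set D -> (D -> E) -> Prop) A0 p0 :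
  P A0 p0 ->
  (forall (F : set (set D * (D -> E))), F !=set0 -> (forall s, F s -> P s.1 s.2) ->
    (forall s t, F s -> F t -> (s.1 `<=` t.1 /\ {in s.1, t.2 =1 s.2}) \/
                             (t.1 `<=` s.1 /\ {in t.1, s.2 =1 t.2})) ->
    forall p, (forall s, F s -> {in s.1, p =1 s.2}) ->
    P (\bigcup_(s in F) s.1) p) ->
  exists A p, P A p /\
    forall B q, P B q -> A `<=` B -> {in A, q =1 p} -> B `<=` A.
Proof.
move=> P0 Pchain; pose St := {s : set D * (D -> E) | P s.1 s.2}.
pose le (s t : St) := (sval s).1 `<=` (sval t).1 /\ {in (sval s).1, (sval t).2 =1 (sval s).2}.
pose R (s t : St) := `[< le s t >].
have [| | |[[A p] /= PA] max] := @ZL_preorder St (exist _ (A0, p0) P0) R.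
- by move=> t; apply/asboolP; split.
- move=> r s t /asboolP[rs1 rs2] /asboolP[st1 st2]; apply/asboolP; split.
    exact: subset_trans st1.
  by move=> x xr; rewrite st2 ?rs2// inE; apply: rs1; exact: set_mem.
- move=> F tF; have [->|/set0P F0] := eqVneq F set0.
    by exists (exist _ (A0, p0) P0).
  pose F' := [set sval s | s in F].
  pose p x := xget (p0 x : {classic E}) [set y | exists s, [/\ F' s, s.1 x & y = s.2 x]].
  have F'tot s t : F' s -> F' t -> (s.1 `<=` t.1 /\ {in s.1, t.2 =1 s.2}) \/
                             (t.1 `<=` s.1 /\ {in t.1, s.2 =1 t.2}).
    by move=> [s' Fs <-] [t' Ft <-]; have [/asboolP|/asboolP] := tF _ _ Fs Ft; [left|right].
  have pE s : F' s -> {in s.1, p =1 s.2}.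
    move=> Fs x /set_mem xs; rewrite /p; case: xgetP => [y _ [t [Ft xt ->]]|/(_ (s.2 x))[]].
      by have [[_ E1]|[_ E1]] := F'tot _ _ Fs Ft; rewrite E1 ?inE.
    by exists s.
  have Pn : P (\bigcup_(s in F') s.1) p.
    apply: Pchain => //; first by case: F0 => s Fs; exists (sval s), s.
    by move=> _ [s Fs <-]; apply: (svalP s).
  exists (exist _ (_, p) Pn) => s Fs; apply/asboolP; split=> /=.
    by move=> x sx; exists (sval s) => //; exists s.
  by apply: pE; exists s.
exists A, p; split=> // B q PB AB qp.
have /asboolP[//] : R (exist _ (B, q) PB) (exist _ (A, p) PA).
by apply: max; apply/asboolP.
Qed.

(* A maximal set of choice functions differing pairwise in every coordinate
   projects onto some [A i], and that [A i] is minimal. *)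
Lemma card_minimal (I : Type) (i0 : I) (T : I -> Type) (A : forall i, set (T i)) :
  exists i, forall j, A i #<= A j.
Proof.
pose P (Z : set (forall i, T i)) := (forall z i, Z z -> A i (z i)) /\
  (forall z z' i, Z z -> Z z' -> z i = z' i -> z = z').
have [|Z [[ZA ZI] Zmax]] := @Zorn_bigcup _ P.
  move=> F FP Ftot; split=> [z i [X FX Xz]|z z' i [X FX Xz] [Y FY Yz']].
    by have [/(_ z i Xz)] := FP _ FX.
  have [XY|YX] := Ftot _ _ FX FY.
    by have [_] := FP _ FY; apply=> //; apply: XY.
  by have [_] := FP _ FX; apply=> //; apply: YX.
have [i Zi] : exists i, forall a, A i a -> exists2 z, Z z & z i = a.
  apply: contrapT => /forallNP nZ.
  have wE i : {a | A i a /\ forall z, Z z -> z i <> a}.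
    apply: cid; have /existsNP[a /not_implyP[Aa na]] := nZ i.
    by exists a; split=> // z Zz za; apply: na; exists z.
  pose w i := sval (wE i); have wP i := svalP (wE i).
  apply: (Zmax (Z `|` [set w])).
    split; first by left.
    by move=> /(_ w (or_intror erefl)) /(proj2 (wP i0)); apply.
  split=> [z i [/ZA//|->]|z z' i]; first by have [] := wP i.
  move=> [Zz|->] [Zz'|->] // E; first exact: ZI E.
    by have [_ /(_ _ Zz)] := wP i.
  by have [_ /(_ _ Zz' (esym E))] := wP i.
exists i => j.
have -> : A i = (fun z => z i) @` Z.
  apply/seteqP; split=> [a /Zi[z]|_ [z Zz <-]]; last exact: ZA.
  by exists z.
apply: card_le_trans (card_image_le _ _) _.
apply: (@card_le_inj _ _ _ _ (fun z => z j)); first by move=> z; apply: ZA.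
by move=> z z' Zz Zz'; apply: ZI.
Qed.

Lemma card_le_total T U (A : set T) (B : set U) : A #<= B \/ B #<= A.
Proof.
have [[] h] := @card_minimal bool true (fun b => if b then T else U)
  (fun b => if b return set (if b then T else U) then A else B).
  by left; apply: (h false).
by right; apply: (h true).
Qed.

Lemma card_ltP T U (A : set T) (B : set U) : ~ (B #<= A) <-> A #< B.
Proof. by split=> [BA|[]//]; split=> //; have [] := card_le_total A B. Qed.

Lemma card_le_lt_trans T U V (A : set T) (B : set U) (C : set V) :
  A #<= B -> B #< C -> A #< C.
Proof.
move=> AB [BC nCB]; split; first exact: card_le_trans BC.
by move=> CA; apply: nCB; apply: card_le_trans AB.
Qed.

Lemma card_lt_le_trans T U V (A : set T) (B : set U) (C : set V) :
  A #< B -> B #<= C -> A #< C.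
Proof.
move=> [AB nBA] BC; split; first exact: card_le_trans BC.
by move=> CA; apply: nBA; apply: card_le_trans CA.
Qed.

Lemma card_set_wf T (P : set T -> Prop) C : P C ->
  exists B, P B /\ forall D, P D -> B #<= D.
Proof.
move=> PC.
have [[B PB] h] := @card_minimal {D | P D} (exist _ C PC) (fun=> T) (@sval _ _).
by exists B; split=> // D PD; apply: (h (exist _ D PD)).
Qed.

Lemma setX_card_le T U V W (A : set T) (B : set U) (C : set V) (D : set W) :
  A #<= C -> B #<= D -> A `*` B #<= C `*` D.
Proof.
move=> AC BD; have [A0|/set0P[a Aa]] := eqVneq A set0; first by rewrite A0 set0X.
have [B0|/set0P[b Bb]] := eqVneq B set0; first by rewrite B0 setX0.
have [c _] : C !=set0.
  by apply/set0P/eqP => C0; move: AC; rewrite C0 card_le0 => /eqP A0; rewrite A0 in Aa.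
have [d _] : D !=set0.
  by apply/set0P/eqP => C0; move: BD; rewrite C0 card_le0 => /eqP A0; rewrite A0 in Bb.
have [f [fC fI]] := card_leW c AC; have [g [gD gI]] := card_leW d BD.
apply: (@card_le_inj _ _ _ _ (fun x => (f x.1, g x.2))).
  by move=> [x y] /= [Ax By]; split; [apply: fC|apply: gD].
by move=> [x y] [x' y'] /= [? ?] [? ?] [/fI -> // /gI ->].
Qed.

Lemma infinite_card_lt T U (A : set T) (B : set U) :
  finite_set A -> infinite_set B -> A #< B.
Proof. by move=> fA iB; apply/card_ltP => /card_le_finite /(_ fA). Qed.

Lemma setX_card_nat : [set: nat] `*` [set: nat] #<= [set: nat].
Proof. by rewrite setXTT; exact: countableP. Qed.

Lemma card_setU_le T U (A C : set T) (B : set U) :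
  infinite_set B -> B `*` B #<= B -> A #<= B -> C #<= B -> A `|` C #<= B.
Proof.
move=> iB BB AB CB; apply: card_le_trans BB.
have n2 : [set: bool] #<= B.
  by case: (infinite_card_lt (@finite_finset bool [set: bool]) iB).
apply: card_le_trans (setX_card_le n2 (card_lexx B)).
have [b0 _] := infinite_setN0 iB.
have [f [fB fI]] := card_leW b0 AB; have [g [gB gI]] := card_leW b0 CB.
apply: (@card_le_inj _ _ _ _ (fun x => if x \in A then (true, f x) else (false, g x))).
  move=> x [Ax|Cx]; first by rewrite mem_set//; split=> //; apply: fB.
  by case: (boolP (x \in A)) => [/set_mem Ax|_]; split=> //; [apply: fB|apply: gB].
move=> x y xU yU; case: (boolP (x \in A)) => [/set_mem Ax|/negP xA];
  case: (boolP (y \in A)) => [/set_mem Ay|/negP yA] // [].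
  by apply: fI.
case: xU => [/mem_set//|Cx]; case: yU => [/mem_set//|Cy]; exact: gI.
Qed.

(** Zorn's lemma gives a maximal injection of the square of some infinite [B] into [B]. If [X] minus
    [B] embeds in [B], then [X] has the size of [B]; otherwise it contains a copy [C] of [B], and
    sending the new pairs of the larger square into [C] extends the injection. *)
Lemma infinite_card_square T (X : set T) : infinite_set X -> X `*` X #<= X.
Proof.
move=> iX.
have [x0 _] := infinite_setN0 iX.
pose P (A : set (T * T)) (p : T * T -> T) := exists B : set T,
  [/\ A = B `*` B, B `<=` X, infinite_set B, forall u, A u -> B (p u) &
      forall u v, A u -> A v -> p u = p v -> u = v].
have sqfst (B : set T) : fst @` (B `*` B) = B.
  apply/seteqP; split=> [_ [[x y] [? ?] <-]//|x Bx]; by exists (x, x).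
have [N [NX Nn]] := card_le_sub (proj1 (infiniteP X) iX).
have iN : infinite_set N by apply/infiniteP; move/card_esym: Nn; rewrite card_eq_le => /andP[].
have NN : N `*` N #<= N.
  move: Nn; rewrite card_eq_le => /andP[N1 N2].
  by apply: card_le_trans N2; apply: card_le_trans setX_card_nat; apply: setX_card_le.
have [p0 [p0N p0I]] := card_leW x0 NN.
have [||A [p [[B [AE BX iB pB pI]] max]]] := @zorn_partial_fun _ _ P (N `*` N) p0.
- by exists N.
- move=> F [s0 Fs0] FP Ftot p pE; exists (\bigcup_(s in F) fst @` s.1); split.
  + apply/seteqP; split=> [u [s Fs su]|[x y] [[s Fs [u su /= ux]] [t Ft [v tv /= vy]]]].
      have [B [sE _ _ _ _]] := FP _ Fs.
      by split; exists s => //; rewrite sE sqfst; move: su; rewrite sE => -[].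
    have [[B [sE _ _ _ _]] [C [tE _ _ _ _]]] := (FP _ Fs, FP _ Ft).
    have [[st _]|[ts _]] := Ftot _ _ Fs Ft.
      exists t => //; move: (st _ su) tv; rewrite tE => -[/= u1 _] [/= v1 _].
      by split; rewrite /= -?ux -?vy.
    exists s => //; move: (ts _ tv) su; rewrite sE => -[/= u1 _] [/= v1 _].
    by split; rewrite /= -?ux -?vy.
  + move=> x [s Fs]; have [B [-> BX _ _ _]] := FP _ Fs; rewrite sqfst; exact: BX.
  + have [B [sE BX iB _ _]] := FP _ Fs0; apply: sub_infinite_set iB.
    by move=> x Bx; exists s0 => //; rewrite sE sqfst.
  + move=> u [s Fs su]; have [B [sE BX iB sB _]] := FP _ Fs; exists s => //.
    by rewrite (pE _ Fs) ?inE// sE sqfst; apply: sB.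
  + move=> u v [s Fs su] [t Ft tv].
    have [[st _]|[ts _]] := Ftot _ _ Fs Ft.
      have [B [_ _ _ _ tI]] := FP _ Ft; rewrite !(pE _ Ft) ?inE; [|exact: tv|exact: st].
      by apply: tI => //; apply: st.
    have [B [_ _ _ _ tI]] := FP _ Fs; rewrite !(pE _ Fs) ?inE; [|exact: ts|exact: su].
    by apply: tI => //; apply: ts.
subst A.
have BB : B `*` B #<= B by apply: card_le_inj pB pI.
have [le|le] := card_le_total (X `\` B) B.
  have XB : X #<= B.
    apply: card_le_trans (card_setU_le iB BB (card_lexx B) le).
    by apply: subset_card_le => x Xx; case: (pselect (B x)); [left|right].
  apply: card_le_trans (subset_card_le BX); apply: card_le_trans BB.
  exact: setX_card_le.
have [C [CX CB]] := card_le_sub le.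
move: CB; rewrite card_eq_le => /andP[CB BC].
have UB : B `|` C #<= B by apply: card_setU_le.
have UC : (B `|` C) `*` (B `|` C) #<= C.
  apply: card_le_trans BC; apply: card_le_trans BB; exact: setX_card_le.
have [q [qC qI]] := card_leW x0 UC.
have nBC x : B x -> C x -> False by move=> Bx /CX[].
pose r u := if u \in B `*` B then p u else q u.
suff : (B `|` C) `*` (B `|` C) `<=` B `*` B.
  have [c Cc] : C !=set0.
    by apply: infinite_setN0 => fC; apply: iB; apply: card_le_finite fC.
  by move=> /(_ (c, c)) [|/= /nBC]; [split; right|move=> /(_ Cc)].
apply: (max _ r); last 2 first.
- by move=> [x y] [? ?]; split; left.
- by move=> u uB; rewrite /r uB.
exists (B `|` C); split=> //.
- by move=> x [/BX//|/CX[]].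
- by apply: sub_infinite_set iB => x; left.
- move=> u Uu; rewrite /r; case: (boolP (u \in _)) => [/set_mem uB|_].
    by left; apply: pB.
  by right; apply: qC.
- move=> u v Uu Uv; rewrite /r.
  case: (boolP (u \in _)) => [/set_mem uB|_]; case: (boolP (v \in _)) => [/set_mem vB|_].
  + exact: pI.
  + by move=> E; exfalso; apply: (nBC (p u)); [exact: pB|rewrite E; apply: qC].
  + by move=> E; exfalso; apply: (nBC (p v)); [exact: pB|rewrite -E; apply: qC].
  + exact: qI.
Qed.

Lemma card_lt_setU T (A B : set T) G : infinite_set [set: G] ->
  A #< [set: G] -> B #< [set: G] -> A `|` B #< [set: G].
Proof.
move=> iG; wlog AB : A B / A #<= B => [hw|] AG BG.
  by have [|] := card_le_total A B => /hw; [|rewrite setUC]; apply.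
have [fB|iB] := pselect (finite_set B).
  apply: infinite_card_lt => //; rewrite finite_setU; split=> //.
  exact: card_le_finite fB.
apply: card_le_lt_trans BG; apply: card_setU_le => //; exact: infinite_card_square.
Qed.

Lemma card_lt_bigcup_seq (I : eqType) T (F : I -> set T) G (s : seq I) :
  infinite_set [set: G] -> (forall i, i \in s -> F i #< [set: G]) ->
  \bigcup_(i in [set` s]) F i #< [set: G].
Proof.
move=> iG; elim: s => [|i s IH] Fs.
  rewrite (_ : \bigcup_(_ in _) _ = set0); last by apply/seteqP; split=> // x [].
  exact: infinite_card_lt.
rewrite (_ : \bigcup_(_ in _) _ = F i `|` \bigcup_(j in [set` s]) F j).
  apply: card_lt_setU => //; first by apply: Fs; rewrite mem_head.
  by apply: IH => j js; apply: Fs; rewrite inE js orbT.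
apply/seteqP; split=> [x [j /=]|x [Fx|[j js Fx]]].
- by rewrite inE => /orP[/eqP->|js]; [left|right; exists j].
- by exists i => //=; rewrite mem_head.
- by exists j => //=; rewrite inE; apply/orP; right.
Qed.

(** A well-order of the type works unless some segment is as large as [C]. In that case the order is
    pulled back along an injection of [C] into the segment of the least such [m]. *)
Lemma initial_order T (C : set T) : exists R : T -> T -> Prop,
  [/\ forall x y, C x -> C y -> R x y \/ R y x,
      forall x y z, C x -> C y -> C z -> R x y -> R y z -> R x z,
      forall x y, C x -> C y -> R x y -> R y x -> x = y &
      forall x, C x -> ~ (C #<= [set y | [/\ C y, R y x & y <> x]])].
Proof.
have [R0 wo] := well_ordering_principle {classic T}.
have woT : wo_chain R0 predT by move=> A _; apply: wo.
have tot : total R0 by move=> x y; apply: (wo_chainW woT).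
have anti : antisymmetric R0.
  by move=> x y; apply: (wo_chain_antisymmetric woT).
have tr : transitive R0.
  move=> y x z Rxy Ryz.
  (* Transitivity is read off from the least element among [x], [y] and [z]. *)
  have [|m [[mA mlb] _]] := wo [pred w | [|| w == x, w == y | w == z]].
    by exists x; rewrite inE eqxx.
  move: mA; rewrite inE => /or3P[] /eqP mE; subst m.
  - by apply: mlb; rewrite inE eqxx !orbT.
  - suff -> : x = y by [].
    by apply: anti; rewrite Rxy mlb// inE eqxx.
  - have yz : y = z by apply: anti; rewrite Ryz mlb// inE eqxx ?orbT.
    by rewrite -yz.
pose seg x := [set y | [/\ C y, R0 y x & y <> x]].
have [[x0 [Cx0 sx0]]|nx] := pselect (exists x, C x /\ C #<= seg x); last first.
  exists R0; split=> [x y _ _|x y z _ _ _|x y _ _ xy yx|x Cx Cs].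
  - exact/orP/tot.
  - exact: tr.
  - by apply: anti; rewrite xy yx.
  - by apply: nx; exists x.
have [|m [[/asboolP[Cm sm] mlb] _]] := wo [pred w | `[< C w /\ C #<= seg w >]].
  by exists x0; apply/asboolP.
have [f [fs fI]] := card_leW m sm.
exists (fun x y => R0 (f x) (f y)); split=> [x y _ _|x y z _ _ _|x y Cx Cy xy yx|x Cx Cs].
- exact/orP/tot.
- exact: tr.
- by apply: fI => //; apply: anti; rewrite xy yx.
have [Cf Rf fm] := fs _ Cx.
apply: fm; apply: anti; rewrite Rf /=; apply: mlb; apply/asboolP; split=> //.
apply: card_le_trans Cs _; apply: (@card_le_inj _ _ _ _ f).
  move=> y [Cy Ry yx]; split=> //; first by case: (fs _ Cy).
  by move=> /(fI _ _ Cy Cx).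
by move=> y z [Cy _ _] [Cz _ _]; apply: fI.
Qed.

(** * Strategies as locally constant functions *)

(** The product topology is a supremum, so convergence of the filter [F] of sets containing a
    cylinder is checked one coordinate at a time. Conversely, a cylinder is a finite intersection of
    neighbourhoods. *)
Lemma nbhs_prod_discrete (I K : Type)
    (p : prod_topology (fun _ : I => discrete_topology {classic K}))
    (U : set (prod_topology (fun _ : I => discrete_topology {classic K}))) :
  nbhs p U <-> exists D : set I, finite_set D /\
    forall q, (forall i, D i -> q i = p i) -> U q.
Proof.
pose F : set_system (prod_topology (fun _ : I => discrete_topology {classic K})) :=
  [set V | exists D : set I, finite_set D /\
    forall q, (forall i, D i -> q i = p i) -> V q].
have FF : Filter F.
  split=> [|V W [D [fD DV]] [E [fE EW]]|V W VW [D [fD DV]]].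
  - by exists set0; split.
  - exists (D `|` E); split=> [|q qE]; first by rewrite finite_setU.
    by split; [apply: DV => i Di|apply: EW => i Ei]; apply: qE; [left|right].
  - by exists D; split=> // q qE; apply: VW; apply: DV.
split=> [|[D [fD DU]]].
  apply: (_ : F --> p); apply/cvg_sup => i A [_ [[B Bop <-] Bp] BA].
  exists [set i]; split=> [|q qE]; first exact: finite_set1.
  by apply: BA => /=; rewrite (qE i).
have Fp : Filter (nbhs p) by apply: nbhs_filter.
have near_i i : nbhs p [set q | q i = p i].
  apply: (proj1 (@cvg_sup _ _ _ (nbhs p) p Fp) (@cvg_id _ _) i).
  exists [set q | q i = p i]; split=> //.
  by exists [set p i]; first exact: discrete_open.
suff : nbhs p (\bigcap_(i in D) [set q | q i = p i]).
  by apply: (@filterS _ _ Fp) => q qD; apply: DU.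
have /(@finite_seqP {classic I})[s ->] := fD.
elim: s => [|i s IH]; first by apply: (@filterS _ _ Fp setT) => //; apply: filterT.
apply: (@filterS _ _ Fp ([set q | q i = p i] `&` \bigcap_(i in [set` s]) [set q | q i = p i])).
  by move=> q [qi qs] j; rewrite /= inE => /orP[/eqP->//|]; apply: qs.
exact: filterI.
Qed.

(* [f] is a continuous function of the hats other than that of [a]. *)
Definition local_at {L K : Type} (f : (L -> K) -> set K) (a : L) : Prop :=
  forall h, exists D : set L, [/\ finite_set D, ~ D a &
    forall h', (forall b, D b -> h' b = h b) -> f h' = f h].

Definition wins (L K G : Type) : Prop :=
  exists f : L -> (L -> K) -> set K,
    [/\ forall a, local_at (f a) a, forall a h, f a h #< [set: G] &
        forall h, exists a, f a h (h a)].

(** Only the hat of [a] itself separates the two descriptions. It is filled in with [k0], and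
    locality makes this choice irrelevant. *)
Lemma winning_gameE (L K G : Type) (k0 : K) :
  winning_game L K G <-> wins L K G.
Proof.
split=> [[f [fc fw]]|[f [fl fs fw]]].
  exists (fun a h => guessed_set (f a (restrict_away h a))); split=> //.
    move=> a h.
    have /nbhs_prod_discrete[D [fD DU]] :
        nbhs (restrict_away h a) [set q | f a q = f a (restrict_away h a)].
      apply: (fc a (restrict_away h a) [set x | x = f a (restrict_away h a)]).
      exact: (@discrete_set1 (guesses K G)).
    exists (val @` D); split=> [||h' h'h]; first exact: finite_image.
      by move=> [[b /set_mem nb] _ /= ba]; apply: nb.
    congr guessed_set; apply: DU => i Di; apply: h'h.
    by exists i.
  by move=> a h; apply: (set_valP (f a (restrict_away h a))).
pose ext a (p : hats_seen K a) : L -> K := fun b =>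
  if pselect (b \in [set~ a]) is left ba then p (exist _ b ba) else k0.
have extE a (p : hats_seen K a) (b : [set~ a]) : ext a p (val b) = p b.
  rewrite /ext; case: pselect => [ba|]; last by case: b => b /= bb; case.
  by congr p; apply: val_inj.
have fext a h : f a (ext a (restrict_away h a)) = f a h.
  have [D [fD Da]] := fl a h; apply=> b Db.
  have ba : b \in [set~ a] by rewrite inE => ba; apply: Da; rewrite -ba.
  exact: (extE a _ (exist _ b ba)).
exists (fun a p => (exist _ (f a (ext a p)) (mem_set (fs a (ext a p))) : guesses K G)).
split=> [a p U /nbhs_singleton Up|h]; last first.
  by have [a fa] := fw h; exists a; move: fa; rewrite -fext.
have [D [fD Da fD']] := fl a (ext a p).
apply/nbhs_prod_discrete; exists (val @^-1` D); split.
  by apply: finite_preimage => // x y _ _; apply: val_inj.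
move=> q qp /=; set x := exist _ _ _.
suff -> : x = exist _ (f a (ext a p)) (mem_set (fs a (ext a p))) :> guesses K G by [].
apply: eq_exist; apply: fD' => b Db.
have ba : b \in [set~ a] by rewrite inE => ba; apply: Da; rewrite -ba.
by have := extE a q (exist _ b ba); have := extE a p (exist _ b ba) => /= -> ->; apply: qp.
Qed.

Lemma wins_inj (L L' K K' G G' : Type) (i : L -> L') (j : K' -> K) :
  injective i -> injective j -> [set: G] #<= [set: G'] ->
  wins L K G -> wins L' K' G'.
Proof.
move=> iI jI GG' [f [fl fs fw]].
exists (fun a' h' => [set k' | exists2 a, a' = i a & f a (j \o h' \o i) (j k')]).
split=> [a' h'|a' h'|h'].
- have [[a ->]|na] := pselect (exists a, a' = i a); last first.
    exists set0; split=> // h'' _.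
    by apply/seteqP; split=> k' [a ai]; case: na; exists a.
  have [D [fD Da fDE]] := fl a (j \o h' \o i).
  exists (i @` D); split=> [||h'' h''h]; first exact: finite_image.
    by move=> [b Db /iI ba]; apply: Da; rewrite -ba.
  have E : f a (j \o h'' \o i) = f a (j \o h' \o i).
    by apply: fDE => b Db /=; rewrite h''h//; exists b.
  by apply/seteqP; split=> k' [b /iI <-] fb; exists a => //; rewrite ?E// -E.
(* A logician [a0] exists, and its guess being smaller than [G] shows that the empty guess is
   too. *)
- have [a0 _] := fw (j \o h' \o i).
  apply: card_lt_le_trans GG'.
  have [[a ->]|na] := pselect (exists a, a' = i a); last first.
    apply: card_le_lt_trans (fs a0 (j \o h' \o i)).
    rewrite [X in X #<= _](_ : _ = set0)//.
    by apply/seteqP; split=> k' // [a ai]; case: na; exists a.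
  apply: card_le_lt_trans (fs a (j \o h' \o i)).
  apply: (@card_le_inj _ _ _ _ j); first by move=> k' [b /iI ->].
  by move=> x y _ _; apply: jI.
- by have [a fa] := fw (j \o h' \o i); exists (i a), a.
Qed.

Lemma wins_mono (L L' K K' G G' : Type) (l : L') (k : K) :
  [set: L] #<= [set: L'] -> [set: K'] #<= [set: K] -> [set: G] #<= [set: G'] ->
  wins L K G -> wins L' K' G'.
Proof.
move=> /(card_leW l)[i [_ iI]] /(card_leW k)[j [_ jI]].
by apply: (@wins_inj _ _ _ _ _ _ i j) => x y; [apply: iI|apply: jI].
Qed.

Lemma local_at_own L K (f : (L -> K) -> set K) a h h' : local_at f a ->
  (forall b, b <> a -> h' b = h b) -> f h' = f h.
Proof.
move=> /(_ h)[D [_ Da fD]] hh'; apply: fD => b Db; apply: hh' => ba.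
by apply: Da; rewrite -ba.
Qed.

Lemma local_at_finite L K (f : (L -> K) -> set K) a : finite_set [set: L] ->
  (forall h h', (forall b, b <> a -> h' b = h b) -> f h' = f h) -> local_at f a.
Proof.
move=> fL fE h; exists [set~ a]; split=> [||h' /(fE h)//]; last by move=> /(_ erefl).
exact: sub_finite_set fL.
Qed.

(** * Finitely many logicians and guesses *)

Lemma card_lt_ord (T : finType) (A : set T) g : A #< [set: 'I_g] ->
  (#|[set x | `[< A x >]]%SET| < g)%N.
Proof.
move=> [_ nA]; rewrite ltnNge; apply/negP => gS; apply: nA.
set S := [set x | _]%SET in gS.
have [g0|g0] := posnP g.
  by rewrite (_ : [set: 'I_g] = set0)//; apply/seteqP; split=> // -[i]; rewrite g0.
have x0 : T by case: (pickP (mem S)) => // /eq_card0 S0; move: gS; rewrite S0 leqNgt g0.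
apply: (@card_le_inj _ _ _ _ (fun i : 'I_g => nth x0 (enum S) i)).
  move=> i _; have : nth x0 (enum S) i \in enum S.
    by rewrite mem_nth// -cardE (leq_trans _ gS).
  by rewrite mem_enum inE => /asboolP.
move=> i j _ _ /eqP; rewrite nth_uniq ?enum_uniq// -?cardE ?(leq_trans _ gS)//.
by move=> /eqP/val_inj.
Qed.

Lemma finite_losing l g : ~ wins 'I_l 'I_(l * (g - 1) + 1) 'I_g.
Proof.
set N := (_ + 1)%N => -[f [fl fs fw]].
pose F a (h : {ffun 'I_l -> 'I_N}) : {set 'I_N} := [set c | `[< f a h c >]]%SET.
have Fg a h : (#|F a h| <= g - 1)%N.
  have := card_lt_ord (fs a h); rewrite -/(F a h) => lt.
  by rewrite -ltnS subn1 prednK// (leq_ltn_trans _ lt).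
pose B a : {set {ffun 'I_l -> 'I_N}} := [set h : {ffun 'I_l -> 'I_N} | h a \in F a h]%SET.
pose upd (h : {ffun 'I_l -> 'I_N}) a c : {ffun 'I_l -> 'I_N} :=
  [ffun b => if b == a then c else h b].
have Fupd a h c : F a (upd h a c) = F a h.
  apply/setP => d; rewrite !inE; congr `[< _ >].
  rewrite (local_at_own (h' := upd h a c) (h := h) (fl a))//.
  by move=> b /eqP/negbTE ba; rewrite ffunE ba.
have BN a : (#|B a| * N <= #|{ffun 'I_l -> 'I_N}| * (g - 1))%N.
  (* From a colouring on which [a] is right and a colour [c], [phi] makes a colouring with [c] on
     [a] and keeps the old colour, which is still among the guesses of [a]. *)
  pose phi (u : {ffun 'I_l -> 'I_N} * 'I_N) := (upd u.1 a u.2, u.1 a).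
  have phiI : injective phi.
    move=> [h c] [h' c'] [/ffunP E Ea]; congr pair; last first.
      by have := E a; rewrite !ffunE eqxx.
    apply/ffunP => b; have := E b; rewrite !ffunE; case: eqP => // -> _.
    exact: Ea.
  have -> : (#|B a| * N = #|(phi @: finset.setX (B a) [set: 'I_N])%SET|)%N.
    by rewrite card_imset// cardsX cardsT card_ord.
  apply: (@leq_trans #|[set u : {ffun 'I_l -> 'I_N} * 'I_N | u.2 \in F a u.1]%SET|).
    apply/subset_leq_card/fintype.subsetP => _ /imsetP[[h c] + ->].
    by rewrite finset.in_setX finset.in_set finset.in_setT andbT finset.in_set /= Fupd.
  rewrite -sum1_card (eq_bigl (fun u => (predT u.1) && (u.2 \in F a u.1)));
    last by move=> u; rewrite inE.
  rewrite -(pair_big_dep predT (fun h c => c \in F a h) (fun _ _ => 1%N)) /=.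
  rewrite -sum_nat_const; apply: leq_sum => h _; rewrite sum1_card; exact: Fg.
have cover : (#|{ffun 'I_l -> 'I_N}| <= \sum_a #|B a|)%N.
  under eq_bigr do rewrite -sum1_card big_mkcond /=.
  rewrite exchange_big -sum1_card /=; apply: leq_sum => h _.
  have [a fa] := fw h; rewrite (bigD1 a)//= inE inE asboolT//.
have N0 : (0 < #|{ffun 'I_l -> 'I_N}|)%N.
  by rewrite card_ffun !card_ord expn_gt0 /N addn1.
(* Summing over the logicians would give [N <= l * (g - 1)]. *)
have : (#|{ffun 'I_l -> 'I_N}| * N <= \sum_(a < l) #|{ffun 'I_l -> 'I_N}| * (g - 1))%N.
  apply: (@leq_trans (\sum_(a < l) #|B a| * N)); last by apply: leq_sum.
  by rewrite -big_distrl leq_mul2r cover orbT.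
by rewrite sum_nat_const card_ord mulnCA leq_pmul2l// /N addn1 ltnn.
Qed.

Lemma finite_winning l g : (0 < l * (g - 1))%N -> wins 'I_l 'I_(l * (g - 1)) 'I_g.
Proof.
set M := (l * _)%N => M0.
have g1 : (0 < g - 1)%N by move: M0; rewrite muln_gt0 => /andP[].
(* The sum of all hats modulo [M], supposing that [a] wears [c]. *)
pose x (a : 'I_l) (h : 'I_l -> 'I_M) (c : nat) := ((\sum_(b < l | b != a) h b + c) %% M)%N.
exists (fun a h => [set c : 'I_M | x a h c %/ (g - 1) = a]); split.
- move=> a; apply: local_at_finite; first exact: finite_finset.
  move=> h h' hh'; apply/seteqP.
  have E : \sum_(b < l | b != a) h' b = \sum_(b < l | b != a) h b.
    by apply: eq_bigr => b /eqP ba; rewrite hh'.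
  by split=> c /=; rewrite /x E.
- move=> a h; apply: (@card_le_lt_trans _ _ _ _ `I_(g - 1)).
    apply: (@card_le_inj _ _ _ _ (fun c : 'I_M => x a h c %% (g - 1))%N).
      by move=> c _ /=; rewrite ltn_mod.
    move=> c c' /= xa xa' E.
    have : x a h c = x a h c' by rewrite (divn_eq (x a h c) (g - 1)) xa E -xa' -divn_eq.
    by move=> /eqP; rewrite eqn_modDl !modn_small// => /eqP/val_inj.
  apply/card_ltP/negP; rewrite -(card_le_eql card_II) card_le_II -ltnNge.
  by rewrite subn1 prednK// -subn_gt0 (leq_trans g1) ?leq_sub2l.
- move=> h; pose y := ((\sum_b h b) %% M)%N.
  have ly : (y %/ (g - 1) < l)%N by rewrite ltn_divLR// ltn_mod.
  have xy a : x a h (h a) = y by rewrite /x /y [in RHS](bigD1 a)//= addnC.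
  by exists (Ordinal ly); rewrite /= xy.
Qed.

(** * Finitely many logicians, infinitely many guesses *)

Lemma card_le_setT T (A : set T) : [set: A] #<= A.
Proof. by have := card_setT A; rewrite card_eq_le => /andP[]. Qed.

Lemma card_ge_setT T (A : set T) : A #<= [set: A].
Proof. by have := card_setT A; rewrite card_eq_le => /andP[]. Qed.

Lemma is_card_succn_le n G S : is_card_succn n G S -> [set: G] #<= [set: S].
Proof.
elim: n S => [|n IH] S /=; first by rewrite card_eq_le => /andP[].
by move=> [X /IH GX [[XS _] _]]; apply: card_le_trans XS.
Qed.

Lemma is_card_succn_unique n G S S' :
  is_card_succn n G S -> is_card_succn n G S' -> [set: S] #<= [set: S'].
Proof.
elim: n S S' => [|n IH] S S' /=.
  by rewrite !card_eq_le => /andP[SG _] /andP[_ GS']; apply: card_le_trans GS'.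
move=> [X GX [_ Smin]] [X' GX' [X'S' _]]; apply: Smin.
by apply: card_le_lt_trans X'S'; apply: IH.
Qed.

Lemma is_card_succ_sub G K (C : set K) : [set: G] #< C ->
  exists2 S : Type, is_card_succ G S & [set: S] #<= C.
Proof.
move=> GC; have [D [GD Dmin]] := card_set_wf (P := fun D => [set: G] #< D) GC.
exists (set_type D); last by apply: card_le_trans (card_le_setT D) (Dmin _ GC).
split; first exact: card_lt_le_trans (card_ge_setT D).
move=> X GX; apply: card_le_trans (card_le_setT D) _.
(* Minimality of [D] concerns sets of elements of [K] only, so a smaller [X] is first copied into
   [K]. *)
have [KX|/card_le_sub[E [_ EX]]] := card_le_total [set: K] [set: X].
  exact: card_le_trans (card_leT D) KX.
move: EX; rewrite card_eq_le => /andP[EX XE].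
apply: card_le_trans EX; apply: Dmin; exact: card_lt_le_trans XE.
Qed.

Lemma bigcup_card_le I T U (V : set I) (F : I -> set T) (Y : set U) :
  (forall i, V i -> F i #<= Y) -> \bigcup_(i in V) F i #<= V `*` Y.
Proof.
move=> FY; set W := \bigcup_(i in V) F i.
have [->|/set0P[t0 [i0 Vi0 Ft0]]] := eqVneq W set0 => //.
have [y0 _] : Y !=set0.
  apply/set0P/eqP => Y0; move: (FY _ Vi0); rewrite Y0 card_le0 => /eqP F0.
  by rewrite F0 in Ft0.
have /choice[g gP] : forall i, exists f : T -> U, V i ->
    (forall x, F i x -> Y (f x)) /\ (forall x y, F i x -> F i y -> f x = f y -> x = y).
  move=> i; have [Vi|nV] := pselect (V i); last by exists (fun=> y0).
  by have [f fP] := card_leW y0 (FY _ Vi); exists f.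
have /choice[s sP] : forall t, exists i, W t -> V i /\ F i t.
  move=> t; have [[i Vi Ft]|nW] := pselect (W t); last by exists i0.
  by exists i.
apply: (@card_le_inj _ _ _ _ (fun t => (s t, g (s t) t))).
  by move=> t /sP[Vs Fs]; split=> //=; have [gY _] := gP _ Vs; apply: gY.
move=> t t' /sP[Vs Fs] /sP[Vs' Fs'] [E]; rewrite -E in Fs' *.
by have [_] := gP _ Vs; apply.
Qed.

(** * Recolouring the first logicians of a numbered set *)

Section Variants.
Variables (L : choiceType) (K : Type) (N : set L) (c : L -> nat).

Definition upd (h : L -> K) a k : L -> K := fun b => if b == a then k else h b.

Definition variants (C : nat -> set K) m (base : L -> K) : set (L -> K) :=
  [set h | (forall x, ~ (N x /\ (c x < m)%N) -> h x = base x) /\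
           (forall x, N x -> (c x < m)%N -> C (c x) (h x))].

Hypothesis cI : forall x y, N x -> N y -> c x = c y -> x = y.

Lemma variantsS C m base x h : N x -> c x = m ->
  variants C m.+1 base h ->
  variants C m base (upd h x (base x)) /\ C m (h x).
Proof.
move=> Nx cx [h1 h2]; split; last by rewrite -cx; apply: h2 => //; rewrite cx.
split=> [y nNy|y Ny cy]; rewrite /upd; case: eqP => [yx|yx]; first by rewrite yx.
  apply: h1 => -[Ny]; rewrite ltnS leq_eqVlt => /orP[/eqP cy|cy]; last exact: nNy.
  by apply: yx; apply: cI => //; rewrite cx.
  by move: cy; rewrite yx cx ltnn.
by apply: h2 => //; apply: ltnW.
Qed.

Lemma variants_upd C m base x k h : N x -> c x = m -> C m k ->
  variants C m (upd base x k) h ->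
  h x = k /\ variants C m.+1 base h.
Proof.
move=> Nx cx Ck [h1 h2].
have hx : h x = k by rewrite h1 /upd ?eqxx// cx ltnn => -[].
split=> //; split=> [y nNy|y Ny].
  rewrite h1 /upd; last by move=> [Ny cy]; apply: nNy; split=> //; apply: ltnW.
  by case: eqP => // yx; case: nNy; rewrite yx cx.
rewrite ltnS leq_eqVlt => /orP[/eqP cy|]; last exact: h2.
by rewrite (cI Ny Nx) ?hx// cx.
Qed.

Lemma variants_none C m base h : ~ (exists x, N x /\ c x = m) ->
  variants C m.+1 base h <-> variants C m base h.
Proof.
move=> nx.
have E x : (N x /\ (c x < m.+1)%N) <-> (N x /\ (c x < m)%N).
  split=> -[Nx cx]; split=> //; last exact: ltnW.
  move: cx; rewrite ltnS leq_eqVlt => /orP[/eqP cx|//].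
  by case: nx; exists x.
split=> -[h1 h2]; split=> [x nNx|x Nx cx].
- by apply: h1 => /E.
- by apply: h2 => //; apply: ltnW.
- by apply: h1 => /E.
- by apply: h2 => //; have [] := (E x).1 (conj Nx cx).
Qed.

(** The step from [X i] to [X i.+1] counts the colours of the logician numbered [i], or does nothing
    if no logician has that number. *)
Lemma card_variants U (X : nat -> set U) C m base : X 0%N !=set0 ->
  (forall i, X i #<= X i.+1) -> (forall i, X i `*` C i #<= X i.+1) ->
  variants C m base #<= X m.
Proof.
move=> [u Xu] XS XC; elim: m => [|m IH].
  apply: (@card_le_inj _ _ _ _ (fun=> u)) => // h h' [h1 _] [h'1 _] _.
  by apply/funext => x; rewrite h1 ?h'1// => -[].
have [[x [Nx cx]]|nx] := pselect (exists x, N x /\ c x = m); last first.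
  apply: card_le_trans (XS m); apply: card_le_trans IH.
  by apply: subset_card_le => h /(variants_none _ _ _ nx).
apply: card_le_trans (XC m); apply: card_le_trans (setX_card_le IH (card_lexx _)).
apply: (@card_le_inj _ _ _ _ (fun h => (upd h x (base x), h x))).
  by move=> h /(variantsS Nx cx).
move=> h h' _ _ [E Ex]; apply/funext => y; have := congr1 (fun h => h y) E.
by rewrite /upd; case: eqP => // ->.
Qed.

Variable f : L -> (L -> K) -> set K.
Hypothesis fl : forall a, local_at (f a) a.

(** The colour [k] is wrong for [x] whatever the earlier logicians wear, so it can be fixed in the
    base colouring before these are defeated. *)
Lemma variants_losing_step C m base x k :
  N x -> c x = m -> (forall h, variants C m base h -> ~ f x h k) ->
  (forall base', exists h, variants C m base' h /\
     forall y, N y -> (c y < m)%N -> ~ f y h (h y)) ->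
  exists h, variants C m (upd base x k) h /\
     forall y, N y -> (c y < m.+1)%N -> ~ f y h (h y).
Proof.
move=> Nx cx xk IH; have [h [hV hw]] := IH (upd base x k); exists h; split=> //.
move=> y Ny; rewrite ltnS leq_eqVlt => /orP[/eqP cy|cy]; last exact: hw.
have -> : y = x by apply: cI => //; rewrite cx.
have [h1 h2] := hV.
rewrite (_ : h x = k); last by rewrite h1 /upd ?eqxx// cx ltnn => -[].
rewrite -(local_at_own (h' := upd h x (base x)) (fl x)); last first.
  by move=> z /eqP/negbTE zx; rewrite /upd zx.
apply: xk; split=> [z nNz|z Nz cz]; rewrite /upd.
  by case: eqP => [->//|/eqP/negbTE zx]; rewrite h1// /upd zx.
by case: eqP => [zx|_]; [move: cz; rewrite zx cx ltnn|apply: h2].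
Qed.

Lemma infinite_losing G : infinite_set [set: G] ->
  (forall a h, f a h #< [set: G]) ->
  forall n S (C : set K), is_card_succn n G S -> [set: S] #<= C ->
  forall base, exists h, variants (fun=> C) n.+1 base h /\
    forall y, N y -> (c y < n.+1)%N -> ~ f y h (h y).
Proof.
move=> iG fs; elim=> [|n IH] S C.
  rewrite /= card_eq_le => /andP[_ GS] SC base.
  have [[x [Nx cx]]|nx] := pselect (exists x, N x /\ c x = 0%N); last first.
    exists base; split=> [|y Ny]; first by apply/variants_none => //; split.
    by rewrite ltnS leqn0 => /eqP cy; case: nx; exists y.
  have [k [Ck nk]] : exists k, C k /\ ~ f x base k.
    apply: contrapT => nk; have [_] := fs x base; apply.
    apply: card_le_trans GS _; apply: card_le_trans SC _.
    by apply: subset_card_le => k Ck; apply: contrapT => fk; apply: nk; exists k.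
  have [] := @variants_losing_step (fun=> C) 0 base x k Nx cx.
  - move=> h [h1 _]; suff -> : h = base by [].
    by apply/funext => y; apply: h1 => -[].
  - by move=> base'; exists base'; split=> //; split.
  by move=> h [/(variants_upd Nx cx Ck)[_ hV] hw]; exists h.
move=> [X GX [XS _]] SC base.
(* The earlier logicians are confined to a set [C'] of the preceding cardinality, which leaves few
   colourings. *)
have [C' [C'C]] : exists C', C' `<=` C /\ C' #= [set: X].
  by apply: card_le_sub; apply: card_le_trans SC; case: XS.
rewrite card_eq_le => /andP[C'X XC'].
have vC h m b : variants (fun=> C') m b h -> variants (fun=> C) m b h.
  by move=> [h1 h2]; split=> // y Ny cy; apply: C'C; apply: h2.
have [[x [Nx cx]]|nx] := pselect (exists x, N x /\ c x = n.+1); last first.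
  have [h [hV hw]] := IH X C' GX XC' base; exists h; split.
    by apply/variants_none => //; apply: vC.
  move=> y Ny; rewrite ltnS leq_eqVlt => /orP[/eqP cy|]; last exact: hw.
  by case: nx; exists y.
have GC' : [set: G] #<= C' by apply: card_le_trans XC'; apply: is_card_succn_le GX.
have iC' : infinite_set C' by move=> /(card_le_finite GC').
have sq := infinite_card_square iC'.
have [k [Ck nk]] : exists k, C k /\ forall h, variants (fun=> C') n.+1 base h -> ~ f x h k.
  apply: contrapT => nk; have [_] := XS; apply.
  apply: card_le_trans SC _; apply: card_le_trans C'X; apply: card_le_trans (sq).
  (* All guesses of [x] over these colourings together number at most the square of [C'], which is
     too few to cover [C]. *)
  apply: (@card_le_trans _ _ _ (\bigcup_(h in variants (fun=> C') n.+1 base) f x h)).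
    apply: subset_card_le => k Ck; apply: contrapT => nf; apply: nk; exists k.
    by split=> // h hV fk; apply: nf; exists h.
  apply: card_le_trans (bigcup_card_le (Y := [set: G]) _) _.
    by move=> h _; case: (fs x h).
  apply: setX_card_le GC'.
  apply: (@card_variants _ (fun=> C')) => [|i|i];
    [exact: infinite_setN0|exact: card_lexx|exact: sq].
have [] := variants_losing_step Nx cx nk; first exact: IH XC'.
move=> h [hV hw]; exists h; split=> //.
by have [] := variants_upd Nx cx Ck (vC _ _ _ hV).
Qed.

Lemma card_II_setX a b : `I_a `*` `I_b #<= `I_(a * b).
Proof.
apply: (@card_le_inj _ _ _ _ (fun x => x.1 * b + x.2)%N).
  move=> [i j] /= [ia jb]; apply: (@leq_trans (i.+1 * b)).
    by rewrite mulSn addnC ltn_add2r.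
  by rewrite leq_mul2r ia orbT.
move=> [i j] [i' j'] /= [_ jb] [_ jb'] E.
have b0 : (0 < b)%N by apply: leq_ltn_trans jb.
have := congr1 (fun x => x %% b)%N E; rewrite !modnMDl !modn_small// => <-.
by have := congr1 (fun x => x %/ b)%N E; rewrite !divnMDl// !divn_small// !addn0 => <-.
Qed.

End Variants.

(* [(colour_bound g m).1] bounds the number of colourings of the first [m]
   logicians when logician [i < m] uses the first [(colour_bound g i).2] colours;
   logician [m] has one colour more than can be guessed over all of these. *)
Fixpoint colour_bound (g m : nat) : nat * nat :=
  let p := if m is m'.+1 then ((colour_bound g m').1 * (colour_bound g m').2)%N
           else 1%N in
  (p, (p * g).+1).

Lemma colour_boundE g m : (colour_bound g m).2 = ((colour_bound g m).1 * g).+1.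
Proof. by case: m. Qed.

(** The colours allowed to a logician depend on its number and on [g], but not on [m]; this is what
    permits a limit over [m]. *)
Lemma bounded_losing (L : choiceType) (N : set L) (c : L -> nat) g
    (f : L -> (L -> nat) -> set nat) :
  (forall x y, N x -> N y -> c x = c y -> x = y) ->
  (forall a, local_at (f a) a) -> (forall a h, f a h #<= `I_g) ->
  forall m base, exists h, variants N c (fun i => `I_(colour_bound g i).2) m base h /\
    forall y, N y -> (c y < m)%N -> ~ f y h (h y).
Proof.
move=> cI fl fs; elim=> [|m IH] base; first by exists base; split.
set C := fun i => `I_(colour_bound g i).2.
have [[x [Nx cx]]|nx] := pselect (exists x, N x /\ c x = m); last first.
  have [h [hV hw]] := IH base; exists h; split; first by apply/variants_none.
  move=> y Ny; rewrite ltnS leq_eqVlt => /orP[/eqP cy|]; last exact: hw.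
  by case: nx; exists y.
have [k [Ck nk]] : exists k, C m k /\ forall h, variants N c C m base h -> ~ f x h k.
  apply: contrapT => nk; suff : C m #<= `I_((colour_bound g m).1 * g).
    by rewrite /C card_le_II colour_boundE ltnn.
  apply: card_le_trans (card_II_setX _ _).
  apply: (@card_le_trans _ _ _ (\bigcup_(h in variants N c C m base) f x h)).
    apply: subset_card_le => k Ck; apply: contrapT => nf; apply: nk; exists k.
    by split=> // h hV fk; apply: nf; exists h.
  apply: card_le_trans (bigcup_card_le (Y := `I_g) _) _; first by [].
  apply: setX_card_le => //.
  apply: (card_variants cI (X := fun i => `I_(colour_bound g i).1)).
  - by exists 0%N.
  - by move=> i; rewrite card_le_II /= leq_pmulr// colour_boundE.
  - by move=> i; apply: card_II_setX.
have [] := variants_losing_step cI fl Nx cx nk IH.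
move=> h [hV hw]; exists h; split=> //.
by have [] := variants_upd cI Nx cx Ck hV.
Qed.

(** The game cut down to the logicians in [B] and the colours in [C], so that an induction can
    remove a logician and shrink the colours without changing types. *)
Definition wins_on (L K G : Type) (B : set L) (C : set K) : Prop :=
  exists f : L -> (L -> K) -> set K,
    [/\ forall a h h', (forall b, B b -> b <> a -> h' b = h b) -> f a h' = f a h,
        forall a h, f a h #< [set: G] &
        forall h, (forall b, B b -> C (h b)) -> exists a, B a /\ f a h (h a)].

Lemma card_eqD1 T (B : set T) b n : B #= `I_n.+1 -> B b -> B `\ b #= `I_n.
Proof.
move=> Bn Bb; have [m Bm] : finite_set (B `\ b).
  by apply: finite_setD; exists n.+1.
suff <- : m = n by [].
have /card_esym Bm1 : B #= `I_m.+1 by apply/eq_cardSP; exists b.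
by have /card_eq_II[] := card_eq_trans Bm1 Bn.
Qed.

Lemma finite_max (I : eqType) T (C : set T) (R : T -> T -> Prop) (s : seq I) (h : I -> T) :
  (forall x y, C x -> C y -> R x y \/ R y x) ->
  (forall x y z, C x -> C y -> C z -> R x y -> R y z -> R x z) ->
  (forall i, i \in s -> C (h i)) -> s != [::] ->
  exists i, i \in s /\ forall j, j \in s -> R (h j) (h i).
Proof.
move=> Rtot Rtr; elim: s => // i s IH sC _.
have Ci : C (h i) by apply: sC; rewrite mem_head.
have Rii : R (h i) (h i) by case: (Rtot _ _ Ci Ci).
have Cs j : j \in s -> C (h j) by move=> js; apply: sC; rewrite inE js orbT.
have [->|s0] := eqVneq s [::].
  by exists i; split=> [|j]; rewrite inE ?eqxx// => /eqP->.
have [j [js jmax]] := IH Cs s0.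
have [Rij|Rji] := Rtot _ _ Ci (Cs _ js).
  exists j; split=> [|l]; first by rewrite inE js orbT.
  by rewrite inE => /orP[/eqP->//|]; apply: jmax.
exists i; split=> [|l]; first by rewrite mem_head.
rewrite inE => /orP[/eqP->//|ls].
by apply: Rtr (jmax _ ls) Rji; [apply: Cs|apply: Cs|].
Qed.

Lemma wins_on_succn (L : choiceType) (K G : Type) n : infinite_set [set: G] ->
  forall (B : set L) (C : set K), B #= `I_n.+1 ->
  (exists2 S : Type, is_card_succn n G S & [set: S] #<= C) \/ wins_on G B C.
Proof.
move=> iG; elim: n => [|n IH] B C Bn.
  have [GC|/card_ltP CG] := pselect ([set: G] #<= C).
    by left; exists G => //=.
  right; exists (fun _ _ => C); split=> // h hC.
  have /eq_cardSP[b Bb _] := Bn; exists b; split=> //; exact: hC.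
have /eq_cardSP[b0 Bb0 _] := Bn.
have [[S GS SC]|[f [f1 f2 f3]]] := IH (B `\ b0) C (card_eqD1 Bn Bb0); last first.
  right; exists f; split=> // [a h h' hh'|h hC].
    by apply: f1 => b [Bb _]; apply: hh'.
  have [|a [[Ba _] fa]] := f3 h; first by move=> b [/hC].
  by exists a.
have [CS|/card_ltP/is_card_succ_sub[S' SS' S'C]] := pselect (C #<= [set: S]); last first.
  by left; exists S' => //; exists S.
right.
have [R [Rtot Rtr Ranti Rseg]] := initial_order C.
pose seg x := [set y | [/\ C y, R y x & y <> x]].
(* [F (b, x)] wins for the logicians other than [b] when their hats lie strictly below [x]: this
   segment is smaller than [C], so it cannot contain a copy of [S], and the induction hypothesis
   applies. *)
have /choice[F FP] : forall u : L * K, exists f : L -> (L -> K) -> set K, B u.1 -> C u.2 ->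
    [/\ forall a h h', (forall b, (B `\ u.1) b -> b <> a -> h' b = h b) -> f a h' = f a h,
        forall a h, f a h #< [set: G] &
        forall h, (forall b, (B `\ u.1) b -> seg u.2 (h b)) ->
          exists a, (B `\ u.1) a /\ f a h (h a)].
  move=> [b x] /=.
  have [[Bb Cx]|nBC] := pselect (B b /\ C x); last first.
    by exists (fun _ _ => set0) => Bb Cx; case: nBC.
  have [[S' GS' S'seg]|[f fP]] := IH (B `\ b) (seg x) (card_eqD1 Bn Bb); last by exists f.
  case: (Rseg _ Cx); apply: card_le_trans S'seg; apply: card_le_trans CS _.
  exact: is_card_succn_unique GS GS'.
pose M a h : set L := [set b | [/\ B b, b <> a, C (h b) &
  forall b', B b' -> b' <> a -> R (h b') (h b)]].
pose m a h := xget a (M a h).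
(* The maximal colour seen is guessed as well, in case two logicians share the maximum. *)
exists (fun a h => [set k | M a h (m a h) /\
  (F (m a h, h (m a h)) a h k \/ k = h (m a h))]); split.
- move=> a h h' hh'.
  have ME : M a h' = M a h.
    apply/seteqP; split=> b [Bb ba Cb bmax]; split=> //.
    + by rewrite -hh'.
    + by move=> b' Bb' b'a; rewrite -!hh'//; apply: bmax.
    + by rewrite hh'.
    + by move=> b' Bb' b'a; rewrite !hh'//; apply: bmax.
  rewrite /m ME; have [Mm|nM] := pselect (M a h (xget a (M a h))); last first.
    by apply/seteqP; split=> k [].
  have [Bm ma Cm _] := Mm.
  have [Fl _ _] := FP (xget a (M a h), h (xget a (M a h))) Bm Cm.
  by rewrite hh'// (Fl a h h')// => b [Bb _]; apply: hh'.
- move=> a h; have [Mm|nM] := pselect (M a h (m a h)); last first.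
    rewrite (_ : mkset _ = set0); last by apply/seteqP; split=> k // [].
    exact: infinite_card_lt.
  have [Bm ma Cm _] := Mm; have [_ Fs _] := FP (m a h, h (m a h)) Bm Cm.
  apply: (@card_le_lt_trans _ _ _ _ (F (m a h, h (m a h)) a h `|` [set h (m a h)])).
    by apply: subset_card_le => k [_ []]; [left|right].
  by apply: card_lt_setU => //; apply: infinite_card_lt => //; apply: finite_set1.
- move=> h hC.
  have [s sB] : exists s : seq L, B = [set` s] by apply/finite_seqP; exists n.+2.
  have [b [Bb bmax]] : exists b, B b /\ forall b', B b' -> R (h b') (h b).
    rewrite sB; apply: (finite_max Rtot Rtr).
      by move=> i si; apply: hC; rewrite sB.
    by apply/eqP => s0; move: Bb0; rewrite sB s0.
  have Mm a : B a -> (exists b', M a h b') -> M a h (m a h).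
    by move=> Ba [b' Mb']; apply: xgetI Mb'.
  (* A shared maximum is seen and guessed by [b]. A unique one is worn by [b] and seen by everyone
     else, and then [F (b, h b)] wins. *)
  have [[b' [Bb' b'b b'max]]|uniq_b] := pselect
      (exists b', [/\ B b', b' <> b & forall b'', B b'' -> R (h b'') (h b')]).
    have {}Mm : M b h (m b h).
      by apply: Mm => //; exists b'; split=> //; [apply: hC|move=> ? ? _; apply: b'max].
    exists b; split=> //; split=> //; right.
    have [Bm mb Cm mmax] := Mm.
    apply: Ranti => //; [exact: hC| |exact: bmax].
    by apply: Rtr (b'max _ Bb) (mmax _ Bb' b'b) => //; apply: hC.
  have below b' : (B `\ b) b' -> seg (h b) (h b').
    move=> [Bb' b'b]; split; [exact: hC|exact: bmax|move=> E].
    by apply: uniq_b; exists b'; split=> // b'' Bb''; rewrite E; apply: bmax.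
  have [_ _ Fw] := FP (b, h b) Bb (hC _ Bb).
  have [a [[Ba ab] Fa]] := Fw h below.
  have Mb : M a h b by split=> //; [exact: nesym|exact: hC|move=> *; apply: bmax].
  have {}Mm : M a h (m a h) by apply: Mm => //; exists b.
  have mb : m a h = b.
    apply: contrapT => mb; have [Bm ma Cm mmax] := Mm.
    have [_ _] := below _ (conj Bm mb); apply.
    by apply: Ranti => //; [exact: hC|exact: bmax|apply: mmax => //; exact: nesym].
  by exists a; split=> //; split=> //; left; rewrite mb.
Qed.

Lemma wins_on_setT (L K G : Type) : finite_set [set: L] ->
  wins_on G [set: L] [set: K] -> wins L K G.
Proof.
move=> fL [f [f1 f2 f3]]; exists f; split=> [a||h] //.
  by apply: local_at_finite => // h h' hh'; apply: f1 => b _; apply: hh'.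
by have [//|a [_ fa]] := f3 h; exists a.
Qed.

(** * Losing games with infinitely many logicians *)

(** A modulus of continuity, chosen for all colourings at once so that positions can be followed
    from list to list. *)
Definition modulus (L : eqType) K (f : L -> (L -> K) -> set K)
    (D : L -> (L -> K) -> seq L) : Prop :=
  (forall a g, a \notin D a g) /\
  forall a g g', {in D a g, g' =1 g} -> f a g' = f a g.

Definition defeated_on L K (f : L -> (L -> K) -> set K) (N : set L) (h : L -> K) :=
  forall g, (forall x, N x -> g x = h x) -> forall a, N a -> ~ f a g (g a).

(** Let [M] be the domain of a maximal partial colouring that defeats the logicians it colours. If
    [a] were outside [M], freezing the colours on [M] would leave a strategy whose lists avoid [M],
    and the set [N] supplied for it would enlarge [M]. *)
Lemma losing_of_extension (L : choiceType) K (k0 : K) (P : set K -> Prop) :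
  (forall (f : L -> (L -> K) -> set K) (D : L -> (L -> K) -> seq L) a0,
     (forall a h, P (f a h)) -> modulus f D ->
     exists N h, [/\ N a0, forall x, N x -> x = a0 \/ exists a g, x \in D a g &
       defeated_on f N h]) ->
  forall f : L -> (L -> K) -> set K, (forall a h, P (f a h)) ->
    (forall a, local_at (f a) a) -> exists h, forall a, ~ f a h (h a).
Proof.
move=> ext f fP fl.
have [||M [h [Mh max]]] := @zorn_partial_fun L K (defeated_on f) set0 (fun=> k0).
- by [].
- move=> F _ FP _ p pE g gp a [s Fs sa]; apply: (FP _ Fs) => // x sx.
  by rewrite gp ?(pE _ Fs) ?inE//; exists s.
exists h => a; apply: (Mh) => //; apply: contrapT => Ma.
pose merge (g : L -> K) x := if x \in M then h x else g x.
have /choice[D DP] : forall u : L * (L -> K), exists s : seq L,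
    u.1 \notin s /\ forall g, {in s, g =1 u.2} -> f u.1 g = f u.1 u.2.
  move=> [b g]; have [D [/finite_seqP[s ->] nb fE]] := fl b g.
  by exists s; split=> [|g' gg']; [apply/negP|apply: fE].
pose D' b g := [seq x <- D (b, merge g) | x \notin M].
have D'P : modulus (fun b g => f b (merge g)) D'.
  split=> [b g|b g g' gg'].
    by rewrite mem_filter negb_and; have [/= -> _] := DP (b, merge g); rewrite orbT.
  have [_ /= fE] := DP (b, merge g); apply: fE => x xD; rewrite /merge.
  by case: ifPn => // xM; apply: gg'; rewrite mem_filter xM.
have [N [h' [Na ND Nh]]] := ext _ _ a (fun b g => fP b (merge g)) D'P.
have NM x : N x -> x \notin M.
  move=> /ND[->|[b [g]]]; first by apply/negP => /set_mem.
  by rewrite mem_filter => /andP[].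
apply: Ma; apply: (max (M `|` N) (merge h')); last by right.
- move=> g gE b [Mb|Nb].
    by apply: Mh => // x Mx; rewrite gE /merge ?mem_set//; left.
  have gg : merge g = g.
    apply/funext => x; rewrite /merge; case: ifPn => // xM.
    by rewrite gE /merge ?xM//; left; apply: set_mem.
  rewrite -[X in f b X]gg; apply: Nh => // x Nx.
  by rewrite gE /merge ?(negbTE (NM _ Nx))//; right.
- by move=> x; left.
- by move=> x xM; rewrite /merge xM.
Qed.

(** * Following the hats that are looked at *)

Section Exploration.
Variables (L : choiceType) (K : choiceType) (c0 : K).
Variables (f : L -> (L -> K) -> set K) (D : L -> (L -> K) -> seq L).
Hypothesis fD : modulus f D.

Definition view (S : seq L) (g : L -> K) : L -> K :=
  fun x => if x \in S then g x else c0.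

(** The modulus is evaluated only at what is known so far, with [c0] elsewhere, so each stage is
    determined by a finite sequence of colours. *)
Fixpoint seen a g i : seq L :=
  if i is j.+1 then seen a g j ++ D a (view (seen a g j) g) else [::].

Definition known (S : seq L) (w : seq K) : L -> K :=
  fun x => if x \in S then nth c0 w (index x S) else c0.

(* [look] is [seen] with the colours given in the order in which they are met. *)
Fixpoint look a (w : seq K) i : seq L :=
  if i is j.+1 then look a w j ++ D a (known (look a w j) w) else [::].

Lemma seen_prefix a g i j : (i <= j)%N -> exists s, seen a g j = seen a g i ++ s.
Proof.
elim: j => [|j IH]; first by rewrite leqn0 => /eqP ->; exists [::].
rewrite leq_eqVlt => /orP[/eqP->|/IH[s E]]; first by exists [::]; rewrite cats0.
by rewrite /= E -catA; eexists.
Qed.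

Lemma seen_subset a g i j : (i <= j)%N -> {subset seen a g i <= seen a g j}.
Proof. by move=> /(seen_prefix a g)[s ->] x xi; rewrite mem_cat xi. Qed.

Lemma seen_self a g i : a \notin seen a g i.
Proof. by elim: i => //= i IH; rewrite mem_cat negb_or IH; have [-> _] := fD. Qed.

Lemma known_view S g : known S (map g S) = view S g.
Proof.
apply/funext => x; rewrite /known /view; case: ifPn => // xS.
by rewrite (nth_map x) ?index_mem// nth_index.
Qed.

(** Stage [i.+1] needs only the colours met by stage [i], hence the bound on [j]. *)
Lemma look_seen a g i j : (j <= i.+1)%N ->
  look a (map g (seen a g i)) j = seen a g j.
Proof.
elim: j => //= j IH ji; rewrite IH; last exact: ltnW.
congr (_ ++ D a _); rewrite -known_view; apply/funext => x; rewrite /known.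
case: ifPn => // xj; have [s ->] := @seen_prefix a g j i ji.
by rewrite map_cat nth_cat size_map index_mem xj.
Qed.

(* Once [i] is large, the positions of [D a g] that are ever seen are all seen by
   stage [i], so [g] and its view at stage [i] have a common extension. *)
Lemma seen_stable a g : exists i0, forall i, (i0 <= i)%N ->
  f a (view (seen a g i) g) = f a g.
Proof.
have [i0 i0P] : exists i0, {in D a g, forall x i, x \in seen a g i -> x \in seen a g i0}.
  elim: (D a g) => [|y s [i IH]]; first by exists 0%N.
  have [[j yj]|ny] := pselect (exists j, y \in seen a g j).
    exists (maxn i j) => x; rewrite inE => /orP[/eqP-> _ _|xs l xl].
      by apply: seen_subset yj; rewrite leq_maxr.
    by apply: (seen_subset (leq_maxl i j)); apply: IH xl.
  exists i => x; rewrite inE => /orP[/eqP-> l yl|]; last exact: IH.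
  by case: ny; exists l.
exists i0 => i ii0; have [_ fE] := fD.
pose g' x := if x \in D a g then g x else view (seen a g i) g x.
rewrite -(fE a g g'); last by move=> x xD; rewrite /g' xD.
apply/esym/fE => x xD; rewrite /g'; case: ifPn => // xDg.
rewrite /view (seen_subset (a := a) (g := g) ii0)//.
by apply: (i0P _ xDg i.+1); rewrite /= mem_cat xD orbT.
Qed.

Lemma seen_closed (N : set L) a g g' :
  (forall g i x, x \in seen a g i -> N x) ->
  (forall x, N x -> g x = g' x) -> f a g = f a g'.
Proof.
move=> Ncl gg'.
have V i : view (seen a g i) g = view (seen a g i) g'.
  by apply/funext => x; rewrite /view; case: ifPn => // /Ncl/gg'.
have E i : seen a g i = seen a g' i by elim: i => //= i IH; rewrite -IH -V.
have [[i iP] [j jP]] := (seen_stable a g, seen_stable a g').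
by rewrite -(iP (maxn i j)) ?leq_maxl// -(jP (maxn i j)) ?leq_maxr// V E.
Qed.

Section Paths.
Variables (I : choiceType) (a0 : L).

(** An item [(i, js, n)] moves from a logician to the [n]-th position it meets within [i] stages
    when it sees the colours named by [js]. With names in a countable [I] the codes are countable,
    however large [K] is. *)
Definition path_code : Type := seq (nat * seq I * nat).

Definition reach (v : I -> K) (p : path_code) : L :=
  foldr (fun t a => nth a (look a (map v t.1.2) t.1.1) t.2) a0 p.

Definition entries (p : path_code) : seq I := flatten [seq t.1.2 | t <- p].

Lemma eq_reach v v' p : {in entries p, v =1 v'} -> reach v p = reach v' p.
Proof.
elim: p => //= t p IH vv'; rewrite IH => [|e ep]; last first.
  by apply: vv'; rewrite /entries /= mem_cat ep orbT.
have -> : map v t.1.2 = map v' t.1.2; last by [].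
by apply/eq_in_map => e et; apply: vv'; rewrite /entries /= mem_cat et.
Qed.

Lemma reach_domain v p : reach v p = a0 \/ exists a g, reach v p \in D a g.
Proof.
elim: p => [|t p IH] /=; first by left.
set a := reach v p in IH *; set w := map v _.
have lookD i x : x \in look a w i -> exists a g, x \in D a g.
  elim: i => //= i IHi; rewrite mem_cat => /orP[/IHi//|xD].
  by exists a, (known (look a w i) w).
have [ti|ti] := ltnP t.2 (size (look a w t.1.1)); last by rewrite nth_default.
by right; apply: lookD (mem_nth _ ti).
Qed.

Lemma reach_seen v p g i x (js : seq I) :
  map g (seen (reach v p) g i) = map v js -> x \in seen (reach v p) g i.+1 ->
  exists q, reach v q = x.
Proof.
move=> E xs.
exists ((i.+1, js, index x (seen (reach v p) g i.+1)) :: p).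
rewrite -[LHS]/(nth (reach v p) (look (reach v p) (map v js) i.+1) _).
by rewrite -E look_seen// nth_index.
Qed.

End Paths.
End Exploration.

(** * Countable sets of logicians defeated on their own *)

Lemma ultra_bounded (U : set_system nat) (u : nat -> nat) m : UltraFilter U ->
  U [set n | (u n < m)%N] -> exists k, U [set n | u n = k].
Proof.
move=> UU; elim: m => [|m IH] Um.
  by exfalso; apply: (@filter_not_empty _ U _); apply: filterS Um.
have [Um'|Um'] := in_ultra_setVsetC [set n | u n = m] UU; first by exists m.
apply: IH; apply: filterS (filterI Um Um') => n [/=].
by rewrite ltnS leq_eqVlt => /orP[/eqP|].
Qed.

Lemma bounded_extension (L : choiceType) g (f : L -> (L -> nat) -> set nat) D a0 :
  (forall a h, f a h #<= `I_g) -> (forall a, local_at (f a) a) -> modulus f D ->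
  exists N h, [/\ N a0, forall x, N x -> x = a0 \/ exists a g, x \in D a g &
    defeated_on f N h].
Proof.
move=> fg fl fD; pose R := reach 0%N D a0 (I := nat) id.
pose N : set L := range R.
pose code x : path_code nat := xget [::] [set p | R p = x].
pose c x := choice.pickle (code x).
have codeK x : N x -> R (code x) = x.
  by move=> [p _ Rp]; have := @xgetI _ [::] [set p | R p = x] p Rp.
have cI x y : N x -> N y -> c x = c y -> x = y.
  by move=> Nx Ny /(pcan_inj choice.pickleK) E; rewrite -(codeK x)// E codeK.
have Ncl a : N a -> forall g i x, x \in seen 0%N D a g i -> N x.
  move=> [p _ <-] g' [//|i] x; set s := seen _ _ _ _ _ => xs.
  have [|q qx] := @reach_seen _ _ 0%N D _ a0 id p g' i x (map g' (seen 0%N D (R p) g' i)) _ xs.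
    by rewrite map_id.
  by exists q.
(* [h n] defeats the logicians of [N] numbered below [n]. Once [c x < n], the colour [h n x] obeys a
   bound depending on [c x] and [g] only, so it is constant on a set in the ultrafilter [U]
   below. *)
have /choice[h hP] := fun n => bounded_losing cI fl fg n (fun=> 0%N).
have [U [UU oU]] := ultraFilterLemma (@eventually_filter).
have far n : U [set m | (n < m)%N] by apply: oU; exists n.+1.
have /choice[h' h'P] : forall x, exists k, N x -> U [set n | h n x = k].
  move=> x; have [Nx|nN] := pselect (N x); last by exists 0%N.
  have [|k kP] := @ultra_bounded U (fun n => h n x) (colour_bound g (c x)).2 UU.
    by apply: filterS (far (c x)) => n /= xn; have [[_ hB] _] := hP n; apply: hB.
  by exists k.
exists N, h'; split=> [|x [p _ <-]|k kE a Na fa].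
- by exists [::].
- exact: reach_domain.
have agree : U [set n | forall x, x \in D a k -> N x -> h n x = h' x].
  elim: (D a k) => [|x s IH]; first by apply: filterS (far 0%N).
  have [Nx|nN] := pselect (N x); last first.
    apply: filterS IH => n nP y; rewrite inE => /orP[/eqP-> //|]; exact: nP.
  apply: filterS (filterI IH (h'P _ Nx)) => n [nP nx] y.
  by rewrite inE => /orP[/eqP-> //|]; apply: nP.
have [n [[nD na] nc]] := filter_ex (filterI (filterI agree (h'P _ Na)) (far (c a))).
have [_ wrong] := hP n; apply: (wrong a Na nc).
rewrite na -(kE _ Na); suff -> : f a (h n) = f a k by [].
(* [k'] has the guess of [h n] because [N] is closed under looking, and that of [k] because they
   agree on [D a k]. *)
pose k' x := if x \in N then h n x else k x.
rewrite -(@seen_closed _ _ 0%N f D fD N a k'); last 2 first.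
- exact: Ncl.
- by move=> x Nx; rewrite /k' mem_set.
have [_ fE] := fD; apply: fE => x xD; rewrite /k'.
by case: ifPn => // /set_mem Nx; rewrite nD// kE.
Qed.

Lemma MInA_extension (L : choiceType) (K : choiceType) (c0 : K) G
    (f : L -> (L -> K) -> set K) D a0 : MInA K G ->
  (forall a h, f a h #< [set: G]) -> modulus f D ->
  exists N h, [/\ N a0, forall x, N x -> x = a0 \/ exists a g, x \in D a g &
    defeated_on f N h].
Proof.
move=> KG fs fD; pose I := (nat * nat)%type.
(* The function coded by [(Es, p, i, js)] takes the colours named in [Es] and returns the guess of
   the logician at the end of [p] after [i] stages with the colours [js]. *)
pose J := (seq I * path_code I * nat * seq I)%type.
pose value (Es : seq I) (v : 'I_(size Es) -> K) : I -> K :=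
  fun e => nth c0 [seq v k | k <- enum 'I_(size Es)] (index e Es).
pose guess (v : I -> K) (p : path_code I) i js :=
  f (reach c0 D a0 v p)
    (known c0 (look c0 D (reach c0 D a0 v p) (map v js) i) (map v js)).
pose F (j : J) : finitary_fun K G := let: (Es, p, i, js) := j in
  existT _ (size Es) (fun v : 'I_(size Es) -> K =>
    exist _ (guess (value Es v) p i js) (mem_set (fs _ _)) : small_sets K G).
have [|A [AN Aind]] := KG (range F).
  by apply: card_le_trans (card_image_le _ _) _; apply: countableP.
have /(card_leW c0)[al0 [al0A al0I]] : [set: nat] #<= A.
  by move: AN; rewrite card_eq_le => /andP[].
pose al (e : I) := al0 (choice.pickle e).
have alA e : A (al e) by apply: al0A.
have alI : injective al by move=> e e' /al0I/(pcan_inj choice.pickleK); apply.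
pose R := reach c0 D a0 al; pose N : set L := range R.
pose code x : path_code I := xget [::] [set p | R p = x].
have codeK x : N x -> R (code x) = x.
  by move=> [p _ Rp]; have := @xgetI _ [::] [set p | R p = x] p Rp.
(* the second component keeps the colour of [x] out of the code of [x] *)
pose c x : I := (choice.pickle (code x), (\max_(e <- entries (code x)) e.2).+1).
have cI x y : N x -> N y -> c x = c y -> x = y.
  by move=> Nx Ny [/(pcan_inj choice.pickleK) E _]; rewrite -(codeK x)// E codeK.
have c_entries x : c x \notin entries (code x).
  apply/negP => cx.
  have := @leq_bigmax_seq _ (entries (code x)) predT (fun e : I => e.2) (c x) cx isT.
  by rewrite ltnn.
exists N, (al \o c); split=> [|x [p _ <-]|g gE a Na].
- by exists [::].
- exact: reach_domain.
have aE := codeK _ Na.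
(* On [N] the colouring takes only values of [al], so whatever [a] sees is reached by one more step
   of a path. *)
have Nseen i : forall x, x \in seen c0 D a g i -> N x.
  elim: i => // i IH x xs.
  have [||q qx] := @reach_seen _ _ c0 D _ a0 al (code a) g i x (map c (seen c0 D a g i)).
  - rewrite -/R aE -map_comp; apply/eq_in_map => y ys; exact/gE/IH.
  - by rewrite -/R aE.
  - by exists q.
have [i /(_ i (leqnn i)) fE] := seen_stable c0 fD a g.
pose S := seen c0 D a g i; pose js := map c S; pose Es := entries (code a) ++ js.
pose v (k : 'I_(size Es)) := al (nth (0, 0)%N Es k).
(* The own colour of [a] is not an argument: it avoids the code of [a] by the choice of [c], and it
   avoids [js] because [a] never sees itself. Independence therefore applies. *)
have caEs : c a \notin Es.
  rewrite mem_cat negb_or c_entries; apply/negP => /mapP[x xS].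
  move=> /(cI _ _ Na (Nseen _ _ xS)) ax.
  by move: xS; rewrite -ax; apply/negP/(seen_self c0 fD).
have valueE : {in Es, value Es v =1 al}.
  move=> e eE; have le : (index e Es < size Es)%N by rewrite index_mem.
  rewrite /value (nth_map (Ordinal le)) ?size_enum_ord// /v nth_enum_ord//.
  by rewrite nth_index.
have := Aind (g a) (F (Es, code a, i, js)); rewrite gE//= => /(_ (alA _)).
move=> /(_ (ex_intro2 _ _ (Es, code a, i, js) Logic.I erefl) v).
move=> /(_ _) H fa; apply: H.
  move=> k; split; first exact: alA.
  by move=> /= /alI E; move: caEs; rewrite -E mem_nth.
have jsE : map (value Es v) js = map g S.
  rewrite -map_comp; apply/eq_in_map => x xS /=.
  rewrite valueE; first by rewrite gE//; apply: Nseen xS.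
  by rewrite mem_cat map_f ?orbT.
have pE : reach c0 D a0 (value Es v) (code a) = a.
  rewrite -[RHS]aE; apply: eq_reach => e ee; apply: valueE.
  by rewrite mem_cat ee.
change (guess (value Es v) (code a) i js (al (c a))).
have -> : guess (value Es v) (code a) i js = f a g.
  by rewrite /guess jsE pE look_seen// known_view fE.
exact: fa.
Qed.

(** * Winning games with infinitely many logicians *)

Lemma exists_first (P : nat -> Prop) : (exists k, P k) ->
  exists k, P k /\ forall j, P j -> (k <= j)%N.
Proof.
move=> [k0 Pk0]; have ex : exists k, `[< P k >] by exists k0; apply/asboolP.
by case: (ex_minnP ex) => k /asboolP Pk kmin; exists k; split=> // j /asboolP/kmin.
Qed.

Lemma set1_lt_infinite K Q (x : K) : infinite_set [set: Q] -> [set x] #< [set: Q].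
Proof. by apply: infinite_card_lt; apply: finite_set1. Qed.

(** * Virtual hats for blocks of logicians *)

Section Blocks.
Variables (K : choiceType) (Q G : Type).
Hypotheses (iG : infinite_set [set: G]) (iQ : infinite_set [set: Q]).

(** Joined to the family so that two equal colours in a block count as a success; a failure of
    independence covers only blocks with distinct colours. *)
Definition singleton_fun : finitary_fun K Q :=
  existT _ 1%N (fun v => exist _ [set v ord0] (mem_set (set1_lt_infinite (v ord0) iQ))).

Variables (F : set (finitary_fun K Q)) (fam : nat -> finitary_fun K Q).
Hypothesis fam0 : fam 0%N = singleton_fun.
Hypothesis famF : forall phi, F phi -> exists k, fam k = phi.
Hypothesis F_dependent : forall A : set K, A #= [set: nat] -> ~ mutually_independent F A.

(* A move [(n, (k, bs))] asserts that the colour at [n] belongs to the value of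
   the [k]-th function at the colours at [bs]. *)
Definition move : Type := (nat * (nat * seq nat))%type.

Definition arity (t : move) := projT1 (fam t.2.1).

Definition sources (t : move) : seq nat := [seq nth 0%N t.2.2 i | i : 'I_(arity t)].

Definition positions (t : move) : seq nat := t.1 :: sources t.

Definition value (t : move) (x : nat -> K) : set K :=
  set_val (projT2 (fam t.2.1) (fun i => x (nth 0%N t.2.2 i))).

Definition success (x : nat -> K) (t : move) : Prop :=
  t.1 \notin sources t /\ value t x (x t.1).

Lemma value_small t x : value t x #< [set: Q].
Proof. exact: (set_valP (projT2 (fam t.2.1) (fun i => x (nth 0%N t.2.2 i)))). Qed.

Lemma eq_value t x y : {in sources t, x =1 y} -> value t x = value t y.
Proof.
move=> xy; rewrite /value; congr set_val; congr (projT2 (fam t.2.1)).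
apply/funext => i; apply: xy.
by apply: (map_f (fun i : 'I_(arity t) => nth 0%N t.2.2 i)); rewrite mem_enum.
Qed.

Lemma eq_success t x y : {in positions t, x =1 y} -> success x t -> success y t.
Proof.
move=> xy [st xt]; split=> //.
rewrite -(@eq_value t x) => [|p pt]; last by apply: xy; rewrite inE pt orbT.
by rewrite -xy// mem_head.
Qed.

(** The position [n] is avoided so that the logician there can find a success without its own hat.
    Away from [n] either a colour repeats, or the colours form a countably infinite set, which is
    dependent. *)
Lemma exists_success x n : exists t, n \notin positions t /\ success x t.
Proof.
have [[m [m' [mm' mn m'n xmm']]]|xI] := pselect
    (exists m m', [/\ m <> m', m <> n, m' <> n & x m = x m']).
  pose t : move := (m, (0%N, [:: m'])).
  have tS : sources t = [:: m'].
    have E : forall phi, phi = singleton_fun ->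
        [seq nth 0%N [:: m'] i | i : 'I_(projT1 phi)] = [:: m'].
      by move=> _ -> /=; rewrite /image_mem enum_ordSl /= enum_ord0.
    exact: E fam0.
  exists t; rewrite /positions tS !inE /=; split.
    by apply/norP; split; apply/eqP/nesym.
  split; first by rewrite tS inE; apply/eqP.
  have E : forall phi, phi = singleton_fun ->
      set_val (projT2 phi (fun i => x (nth 0%N [:: m'] i))) (x m).
    by move=> _ -> /=.
  exact: E fam0.
pose A := x @` [set~ n].
have AN : A #= [set: nat].
  apply: Cantor_Bernstein.
    by apply: card_le_trans (card_image_le _ _) _; apply: countableP.
  apply: (@card_le_inj _ _ _ _ (x \o bump n)).
    move=> m _; exists (bump n m) => //= E.
    by have := neq_bump n m; rewrite E eqxx.
  move=> m m' _ _ /= E; apply: (can_inj (bumpK n)); apply: contrapT => mm'; apply: xI.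
  by exists (bump n m), (bump n m'); split=> //; apply/eqP; rewrite eq_sym neq_bump.
have /existsNP[a /existsNP[phi]] := F_dependent AN.
move=> /not_implyP[[m mn <-]] /not_implyP[/famF[k <-]] /existsNP[v].
move=> /not_implyP[vA /contrapT kv].
have /choice[b bP] : forall i, exists p, p <> n /\ x p = v i.
  by move=> i; have [[p pn pv] _] := vA i; exists p.
pose t : move := (m, (k, [seq b i | i : 'I_(projT1 (fam k))])).
have nthb (i : 'I_(projT1 (fam k))) :
    nth 0%N [seq b i | i : 'I_(projT1 (fam k))] i = b i.
  by rewrite (nth_map i) ?size_enum_ord// nth_ord_enum.
have tS p : p \in sources t -> exists i, p = b i.
  by move=> /mapP[i _ ->]; exists i; rewrite -nthb.
exists t; split.
  rewrite inE negb_or; apply/andP; split; first exact/eqP/nesym.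
  by apply/negP => /tS[i]; apply/nesym; have [] := bP i.
split.
  apply/negP => /tS[i /= mb]; have [_] := vA i; apply.
  by have [_ <-] := bP i; rewrite -mb.
rewrite /value /= (_ : (fun i => _) = v)//.
by apply/funext => i; rewrite nthb; have [] := bP i.
Qed.

Definition move_of_nat (k : nat) : move := odflt (0%N, (0%N, [::])) (choice.unpickle k).

Lemma move_of_nat_surj t : exists k, move_of_nat k = t.
Proof. by exists (choice.pickle t); rewrite /move_of_nat choice.pickleK. Qed.

Lemma block_winning : wins nat Q G -> wins (nat * nat) K G.
Proof.
move=> [s [sl ss sw]].
have [q0 _] := infinite_setN0 iQ.
(* [io A] codes the elements of a small set [A] of colours injectively in [Q]. *)
have /choice[io ioI] : forall A : set K, exists i : K -> Q, A #< [set: Q] ->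
    forall x y, A x -> A y -> i x = i y -> x = y.
  move=> A; have [[AQ nQA]|nA] := pselect (A #< [set: Q]); last by exists (fun=> q0).
  by have [i [_ iI]] := card_leW q0 AQ; exists i.
have /choice[tau tauP] : forall x, exists k, success x (move_of_nat k) /\
    forall j, success x (move_of_nat j) -> (k <= j)%N.
  move=> x; apply: exists_first; have [t [_ xt]] := exists_success x 0%N.
  by have [k kt] := move_of_nat_surj t; exists k; rewrite kt.
(* [tau x] is the least successful move of a block. The logician at [n] cannot compute it, but it
   can compute the bound [T (x, n)], the least success not involving [n]. *)
have /choice[T TP] : forall u : (nat -> K) * nat, exists k,
    (u.2 \notin positions (move_of_nat k) /\ success u.1 (move_of_nat k)) /\
    forall j, u.2 \notin positions (move_of_nat j) /\ success u.1 (move_of_nat j) -> (k <= j)%N.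
  move=> [x n]; apply: exists_first; have [t [nt xt]] := exists_success x n.
  by have [k kt] := move_of_nat_surj t; exists k; rewrite kt.
pose upto m := flatten [seq positions (move_of_nat k) | k <- iota 0 m.+1].
have uptoP m k : (k <= m)%N -> {subset positions (move_of_nat k) <= upto m}.
  move=> km p pk; apply/flatten_mapP; exists k => //.
  by rewrite mem_iota add0n ltnS.
have eq_tau x y : {in upto (tau x), x =1 y} -> tau y = tau x.
  move=> xy; have [[sx xmin] [sy ymin]] := (tauP x, tauP y).
  have yx : (tau y <= tau x)%N.
    apply: ymin; apply: eq_success sx => p px; apply: xy; exact: uptoP px.
  apply/eqP; rewrite eqn_leq yx; apply: xmin; apply: eq_success sy => p px.
  apply/esym/xy; exact: uptoP px.
have eq_T x y n : {in upto (T (x, n)), forall p, p <> n -> x p = y p} -> T (y, n) = T (x, n).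
  move=> xy; have [[[/= nx sx] xmin] [[/= ny sy] ymin]] := (TP (x, n), TP (y, n)).
  have yx : (T (y, n) <= T (x, n))%N.
    apply: ymin; split=> //; apply: eq_success sx => p px; apply: xy; first exact: uptoP px.
    by move=> pn; move: nx; rewrite -{1}pn px.
  apply/eqP; rewrite eqn_leq yx; apply: xmin; split=> //.
  apply: eq_success sy => p px.
  apply/esym/xy; first exact: uptoP px.
  by move=> pn; move: ny; rewrite -{1}pn px.
(* The virtual hat of a block codes the colour targeted by its least successful move. *)
pose xi x := io (value (move_of_nat (tau x)) x) (x (move_of_nat (tau x)).1).
have eq_xi x y : {in upto (tau x), x =1 y} -> xi y = xi x.
  move=> xy; rewrite /xi (eq_tau _ _ xy).
  rewrite -(@eq_value _ x) => [|p px]; last first.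
    by apply: xy; apply: (uptoP _ (tau x)) => //; rewrite inE px orbT.
  by rewrite -xy//; apply: (uptoP _ (tau x)) => //; rewrite inE eqxx.
pose blk (h : nat * nat -> K) j := fun n => h (j, n).
pose V j h := s j (fun i => xi (blk h i)).
(* The guesses of logician [n] of block [j] if [m] is the least successful move: the colours whose
   code is guessed by [s j]. Taking the union over the finitely many [m] up to [T] keeps the guesses
   fewer than [G]. *)
pose W j n h m := [set k | [/\ (move_of_nat m).1 = n, n \notin sources (move_of_nat m),
  value (move_of_nat m) (blk h j) k & V j h (io (value (move_of_nat m) (blk h j)) k)]].
exists (fun u h => \bigcup_(m in `I_(T (blk h u.1, u.2)).+1) W u.1 u.2 h m).
split=> [[j n] h|[j n] h|h].
- have [Ds [fDs nDs DsE]] := sl j (fun i => xi (blk h i)).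
  pose D1 := \bigcup_(i in Ds) (pair i @` [set` upto (tau (blk h i))]).
  pose D2 := (pair j @` ([set` upto (T (blk h j, n))] `\ n)).
  exists (D1 `|` D2); split=> [||h' hh'].
  + rewrite finite_setU; split.
      by apply: bigcup_finite => // i _; apply: finite_image; apply: finite_seq.
    by apply: finite_image; apply: finite_setD; apply: finite_seq.
  + by move=> [[i Di [p _ [ij _]]]|[p [_ pn] [pn']]]; [rewrite -ij in nDs|].
  have VE : V j h' = V j h.
    apply: DsE => i Di; apply: eq_xi => p pi; apply/esym/hh'.
    by left; exists i => //; exists p.
  have blkE : {in upto (T (blk h j, n)), forall p, p <> n -> blk h j p = blk h' j p}.
    by move=> p pT pn; apply/esym/hh'; right; exists p.
  rewrite /= (eq_T _ _ _ blkE); apply: eq_bigcupr => m /=.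
  rewrite ltnS => mT.
  have WE : n \notin sources (move_of_nat m) ->
      value (move_of_nat m) (blk h' j) = value (move_of_nat m) (blk h j).
    move=> nS; apply/esym/eq_value => p pS; apply: blkE.
      by apply: (uptoP _ m) => //; rewrite inE pS orbT.
    by move=> pn; move: nS; rewrite -pn pS.
  by apply/seteqP; split=> k [mn nS]; rewrite /W /= WE// VE.
- have /finite_seqP[r ->] := finite_II (T (blk h j, n)).+1.
  apply: card_lt_bigcup_seq => // m _; apply: card_le_lt_trans (ss j (fun i => xi (blk h i))).
  apply: (@card_le_inj _ _ _ _ (io (value (move_of_nat m) (blk h j)))) => [k []//|k k'].
  by move=> [_ _ kv _] [_ _ kv' _]; apply: ioI => //; apply: value_small.
- have [j sj] := sw (fun i => xi (blk h i)); set x := blk h j in sj.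
  have [[tS tv] tmin] := tauP x.
  exists (j, (move_of_nat (tau x)).1), (tau x) => //=.
  rewrite ltnS; apply: tmin.
  by have [[]] := TP (x, (move_of_nat (tau x)).1).
Qed.

End Blocks.

Lemma wins_of_not_MInA (K Q G : Type) : infinite_set [set: G] ->
  infinite_set [set: Q] -> ~ MInA K Q -> wins nat Q G -> wins (nat * nat) K G.
Proof.
move=> iG iQ /existsNP[F /not_implyP[cF nF]] wQ.
have [e [_ eI]] := card_leW 0%N cF.
pose fam n : finitary_fun {classic K} Q := if n is m.+1 then
    xget (singleton_fun {classic K} iQ : {classic finitary_fun {classic K} Q})
      [set phi | F phi /\ e phi = m]
  else singleton_fun {classic K} iQ.
apply: (@block_winning {classic K} Q G iG iQ F fam) => //.
- move=> phi Fphi; exists (e phi).+1; rewrite /fam; case: xgetP => [psi _ [Fpsi]|].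
    by move=> /eI; apply.
  by move=> /(_ phi)[].
- by move=> A AN indA; apply: nF; exists A.
Qed.

(** * The classification *)

Lemma card_le_inhab T U (A : set T) (B : set U) : A !=set0 -> A #<= B -> B !=set0.
Proof.
move=> [x Ax] AB; apply/set0P/eqP => B0; move: AB; rewrite B0 card_le0 => /eqP A0.
by rewrite A0 in Ax.
Qed.

Lemma card_eq_ord T n : [set: T] #= `I_n ->
  [set: T] #<= [set: 'I_n] /\ [set: 'I_n] #<= [set: T].
Proof.
move=> Tn; have : [set: T] #= [set: 'I_n] by apply: card_eq_trans Tn card_II.
by rewrite card_eq_le => /andP[].
Qed.

Lemma card_ord_II n : [set: 'I_n] #<= `I_n.
Proof. by have := @card_II n; rewrite card_eq_le => /andP[]. Qed.

Lemma card_II_ord n : `I_n #<= [set: 'I_n].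
Proof. by have := @card_II n; rewrite card_eq_le => /andP[]. Qed.

Lemma modulus_local (L : eqType) K (f : L -> (L -> K) -> set K) D :
  modulus f D -> forall a, local_at (f a) a.
Proof.
move=> [nD fD] a h; exists [set` D a h]; split; first exact: finite_seq.
  exact/negP.
by move=> h' hh'; apply: fD.
Qed.

Lemma losing_case_not_wins (L K G : Type) (l0 : L) :
  losing_case L K G -> ~ wins L K G.
Proof.
case=> [[l [g [Ll Gg NK]]]|[l [S [Ll iG GS SK]]]|[iL [g Gg] iK]|[iL iG [M [[iM MM] GM MK]]]].
- move=> w; apply: (@finite_losing l g).
  have [[LL _] [GG _]] := (card_eq_ord Ll, card_eq_ord Gg).
  have [i _] := card_le_inhab (ex_intro _ l0 Logic.I) LL.
  have NK' := card_le_trans (card_ord_II _) NK.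
  have [k _] : [set: K] !=set0.
    by apply: card_le_inhab NK; exists 0%N; rewrite /= addn1.
  exact: (wins_mono i k LL NK' GG w).
- have [c [cl cI]] : exists c : L -> nat, (forall x, [set: L] x -> `I_l (c x)) /\
      forall x y, [set: L] x -> [set: L] y -> c x = c y -> x = y.
    by apply: card_leW => //; move: Ll; rewrite card_eq_le => /andP[].
  have l1 : (0 < l)%N by have := cl l0 Logic.I; case: (l).
  have [k0 _] : [set: K] !=set0.
    apply: card_le_inhab SK; apply: card_le_inhab (is_card_succn_le GS).
    exact: infinite_setN0.
  move=> [f [fl fs fw]].
  have [h [_ hw]] := @infinite_losing {classic L} K [set: L] c cI f fl G iG fs
    (l - 1) S [set: K] GS SK (fun=> k0).
  have [a] := fw h; apply: hw => //.
  by rewrite subn1 prednK//; apply: cl.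
- move=> w; have [_ GG] := card_eq_ord Gg.
  have nK : [set: nat] #<= [set: K] by apply/infiniteP.
  have [k _] := card_le_inhab (ex_intro _ 0%N Logic.I) nK.
  have [f [fl fs fw]] := wins_mono l0 k (card_lexx _) nK (card_lexx _) w.
  have [||//|h hw] := @losing_of_extension {classic L} nat 0%N (fun A => A #<= `I_g) _ f.
  + move=> f' D a0 f's f'D; apply: bounded_extension (f'D) => //.
    exact: modulus_local f'D.
  + move=> a h; apply: (card_le_trans (proj1 (fs a h))).
    by move: Gg; rewrite card_eq_le => /andP[].
  by have [a] := fw h; apply: hw.
- move=> w; have MG := MM _ iG GM.
  have [m _] := infinite_setN0 iM.
  have [k _] := card_le_inhab (ex_intro _ m Logic.I) MK.
  have [f [fl fs fw]] := wins_mono l0 k (card_lexx _) MK (card_lexx _) w.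
  have [||//|h hw] := @losing_of_extension {classic L} {classic M} m
    (fun A => A #< [set: G]) _ f => //.
    by move=> f' D a0; apply: MInA_extension.
  by have [a] := fw h; apply: hw.
Qed.

Lemma wins_nat (K G : Type) (k0 : K) : infinite_set [set: G] ->
  (forall M : Type, strongly_MInA M -> [set: G] #< [set: M] ->
     ~ ([set: M] #<= [set: K])) ->
  wins nat K G.
Proof.
move=> iG noM.
(* A counterexample of least cardinality is sought among the nonempty sets of colours in [K]. *)
pose P (C : set K) := C !=set0 /\ ~ wins nat (set_type C) G.
suff nP C : ~ P C.
  have [w|nw] := pselect (wins nat (set_type [set: K]) G); last first.
    by case: (nP setT); split=> //; exists k0.
  by apply: (wins_mono 0%N (exist _ k0 (mem_set Logic.I)) _ (card_ge_setT _) _ w).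
move=> /card_set_wf{C} [C [[[c Cc] nw] Cmin]]; apply: nw.
pose c' : set_type C := exist _ c (mem_set Cc).
(* With at most as many colours as [G], two logicians already win. *)
have [CG|/card_ltP GC] := pselect (C #<= [set: G]).
  have [|[S [X XG [[XS nSX] _]] SC]|w] :=
    @wins_on_succn 'I_2 (set_type C) G 1 iG setT setT.
  - by rewrite card_eq_sym card_II.
  - exfalso; apply: nSX; apply: card_le_trans SC _.
    apply: card_le_trans (card_le_setT C) _; apply: card_le_trans CG _.
    by move: XG; rewrite /= card_eq_le => /andP[].
  have {}w := wins_on_setT (@finite_finset _ _) w.
  apply: (wins_mono 0%N c' _ _ _ w) => //.
  apply: card_le_trans (card_ord_II 2) _; exact: card_leT.
have GC' : [set: G] #< [set: set_type C] by apply: card_lt_le_trans (card_ge_setT C).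
have iC : infinite_set [set: set_type C].
  by move=> /(card_le_finite (proj1 GC')).
have CK : [set: set_type C] #<= [set: K].
  exact: card_le_trans (card_le_setT C) (card_leT C).
(* [C] is above [G] and not strongly MInA, which gives a smaller [Q] whose property fails; by
   minimality of [C], the game with colours [Q] is won. *)
have [Q [iQ QC nMQ]] : exists Q : Type,
    [/\ infinite_set [set: Q], [set: Q] #< [set: set_type C] & ~ MInA (set_type C) Q].
  apply: contrapT => nQ; apply: (noM (set_type C)) => //; split=> // Q iQ QC.
  by apply: contrapT => nM; apply: nQ; exists Q.
have [C' [_]] := card_le_sub (card_le_trans (proj1 QC) (card_le_setT C)).
rewrite card_eq_le => /andP[C'Q QC'].
have [b C'b] := card_le_inhab (infinite_setN0 iQ) QC'.
have wC' : wins nat (set_type C') G.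
  apply: contrapT => nw; have [_] := QC; apply.
  apply: card_le_trans (card_le_setT C) _; apply: card_le_trans C'Q.
  by apply: Cmin; split=> //; exists b.
have wQ : wins nat Q G.
  apply: (wins_mono 0%N (exist _ b (mem_set C'b)) _ _ _ wC') => //.
  exact: card_le_trans (card_ge_setT C').
have w := wins_of_not_MInA iG iQ nMQ wQ.
by apply: (wins_mono 0%N c' _ _ _ w) => //; apply: countableP.
Qed.

Lemma wins_of_not_losing_case (L K G : Type) (l0 : L) (k0 : K) :
  `I_2 #<= [set: G] -> ~ losing_case L K G -> wins L K G.
Proof.
move=> G2 nl.
have g2 g : [set: G] #= `I_g -> (1 < g)%N.
  by move=> Gg; rewrite -card_le_II -(card_le_eqr Gg).
have l1 l : [set: L] #= `I_l -> (0 < l)%N.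
  move=> Ll; have [LL _] := card_eq_ord Ll.
  by have [[i il] _] := card_le_inhab (ex_intro _ l0 Logic.I) LL; apply: leq_ltn_trans il.
have [[l Ll]|iL] := pselect (finite_set [set: L]);
  have [[g Gg]|iG] := pselect (finite_set [set: G]).
- have lg : (0 < l * (g - 1))%N by rewrite muln_gt0 l1//= subn_gt0 g2.
  have KN : ~ (`I_(l * (g - 1) + 1) #<= [set: K]).
    by move=> NK; apply: nl; constructor 1; exists l, g.
  have [[_ LL] [_ GG]] := (card_eq_ord Ll, card_eq_ord Gg).
  apply: (wins_mono l0 (Ordinal lg) LL _ GG (finite_winning lg)).
  have /card_ltP[KN' _] := KN.
  have [k Kk] : finite_set [set: K] by apply: card_le_finite KN' _; apply: finite_II.
  apply: card_le_trans (card_II_ord _); rewrite (card_le_eql Kk) card_le_II.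
  by move: KN; rewrite (card_le_eqr Kk) card_le_II => /negP; rewrite -ltnNge addn1.
- have [||w] := @wins_on_succn {classic L} K G (l - 1) iG setT setT.
  + by rewrite subn1 prednK// l1.
  + move=> [S GS SK]; case: nl; constructor 2; exists l, S; split=> //.
  + by apply: wins_on_setT => //; exists l.
- have [[k Kk]|iK] := pselect (finite_set [set: K]); last first.
    by case: nl; constructor 3; split=> //; exists g.
  have [KK _] := card_eq_ord Kk.
  have [k' _] := card_le_inhab (ex_intro _ k0 Logic.I) KK.
  have k1 : (0 < k)%N by apply: leq_ltn_trans (ltn_ord k').
  (* With [k] colours, [k] of the logicians suffice, as [k <= k * (g - 1)]. *)
  have kg : (0 < k * (g - 1))%N by rewrite muln_gt0 k1 subn_gt0 g2.
  have [_ GG] := card_eq_ord Gg.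
  apply: (wins_mono l0 (Ordinal kg) _ _ GG (finite_winning kg)).
    apply: card_le_trans (card_ord_II k) _; apply: card_le_trans (card_leT _) _.
    exact/infiniteP.
  apply: card_le_trans (card_II_ord _); rewrite (card_le_eql Kk) card_le_II.
  by rewrite leq_pmulr// subn_gt0 g2.
- have nL : [set: nat] #<= [set: L] by apply/infiniteP.
  apply: (wins_mono l0 k0 nL (card_lexx _) (card_lexx _)); apply: wins_nat => //.
  move=> M sM GM MK; apply: nl; constructor 4; split=> //.
  by exists M.
Qed.

Unset Implicit Arguments.

Theorem theoremA (L K G : Type)
    (L_ge1 : `I_1 #<= [set: L]) (K_ge1 : `I_1 #<= [set: K])
    (G_ge2 : `I_2 #<= [set: G]) :
  (losing_game L K G <-> losing_case L K G) /\
  (~ losing_case L K G -> winning_game L K G).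
Proof.
have I1 : `I_1 !=set0 by exists 0%N.
have [[l0 _] [k0 _]] := (card_le_inhab I1 L_ge1, card_le_inhab I1 K_ge1).
rewrite /losing_game (winning_gameE L G k0).
have win := @wins_of_not_losing_case L K G l0 k0 G_ge2.
split=> //; split; last exact: losing_case_not_wins.
by move=> nw; apply: contrapT => /win.
Qed.
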